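(* Let $\lambda=(N,\psi,O,R,\{e_i\})$ be an s-space over a manifold $M$, let $k=\dim O$, let $\mathfrak{o}$ be the Lie algebra of $O$, and let $s=\dim S_z$ (which does not depend on $z\in N$), where $S_z$ is the stabilizer of $z$. Suppose that there exists a linear subspace $\tilde V$ of $\mathfrak{o}$ such that $\dim\tilde V=k-s$ and $\tilde V\cap T_eS_z=\{0\}$ for all $z\in N$. If $\lambda$ admits a connection, then the tangent bundle of $N$ is trivial.
   Context: All manifolds and maps are smooth; $M_p$, $N_z$ denote tangent spaces. An s-space over an $n$-dimensional manifold $M$ is a collection $\lambda=(N,\psi,O,R,\{e_i\})$ where: (a) $N$ is a manifold; (b) $\psi:N\to M$ is a surjective submersion; (c) $O$ is a Lie group and $R$ is a right action of $O$ on $N$, written $R_a(z)=z.a$, with $\psi\circ R_a=\psi$ for all $a\in O$, and transitive on each fiber of $\psi$; (d) $e_i:N\to TM$, $1\le i\le n$, are differentiable functions such that $\{e_1(z),\dots,e_n(z)\}$ is a basis of $M_{\psi(z)}$ for all $z\in N$. All s-spaces are assumed to have rigid base change: there is a differentiable map $L:O\to GL(n)$ (the base change morphism, which is a group morphism) such that $e_i(z.a)=\sum_{l=1}^n e_l(z)L(a)^l_i$ for all $z\in N$, $a\in O$, $1\le i\le n$. The stabilizer is $S_z=\{a\in O: z.a=z\}$; its tangent space $T_eS_z$ at the unit $e$ is regarded as a subspace of $\mathfrak{o}=T_eO$; its dimension is the same for all $z\in N$. The vertical subspace at $z$ is $V_z=\ker\psi_{*_z}\subseteq N_z$. A connection on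 $\lambda$ is a $(1,1)$ tensor field $\phi$ on $N$ such that: (1) $\phi_z:N_z\to V_z$ is linear; (2) $\phi^2=\phi$ and $\phi_z$ is a projection onto the vertical subspace $V_z$; (3) $\phi_{z.a}((R_a)_{*_z}(b))=(R_a)_{*_z}(\phi_z(b))$ for all $z\in N$, $b\in N_z$, $a\in O$. *)

(* Defs.v *)
From HB Require Import structures.
From mathcomp Require Import all_boot all_order all_algebra.
From mathcomp Require Import all_classical all_reals all_analysis.
Import GRing.Theory Num.Theory numFieldNormedType.Exports.

Set Implicit Arguments.
Unset Strict Implicit.
Unset Printing Implicit Defensive.

Local Open Scope classical_set_scope.
Local Open Scope ring_scope.

(* Meaningful when U is open; values of f outside U are irrelevant then. *)
Fixpoint cont_diff (R : realType) (V W : normedModType R) (k : nat)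
    (U : set V) (f : V -> W) : Prop :=
  if k is k'.+1 then
    (forall x, U x -> differentiable f x) /\
    (forall v, cont_diff k' U (fun x => 'D_v f x : W))
  else forall x, U x -> {for x, continuous f}.

Definition smooth_on (R : realType) (V W : normedModType R)
    (U : set V) (f : V -> W) : Prop := forall k, cont_diff k U f.

(* A bare family of coordinate systems, valued in R^n; the chart axioms are
   in [manifold].  [crd i p] is meaningful only when [dom i p]. *)
Record atlas (R : realType) (n : nat) (T : Type) := Atlas {
  idx : Type;
  dom : idx -> set T;
  crd : idx -> T -> 'rV[R]_n }.

Definition euclid (R : realType) (n : nat) : atlas R n 'rV[R]_n :=
  @Atlas R n _ unit (fun _ => setT) (fun _ x => x).

Definition prod_atlas (R : realType) m n S T (A : atlas R m S) (B : atlas R n T) :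
    atlas R (m + n) (S * T) :=
  @Atlas R (m + n) _ (idx A * idx B)%type
    (fun ij => dom ij.1 `*` dom ij.2)
    (fun ij p => row_mx (crd ij.1 p.1) (crd ij.2 p.2)).

Section Maps.
Context {R : realType} {m n : nat} {S T : Type} (A : atlas R m S) (B : atlas R n T).

Definition local_dom (f : S -> T) (i : idx A) (j : idx B) : set 'rV[R]_m :=
  crd i @` (dom i `&` f @^-1` dom j).

(* The coordinate expression crd j \o f \o (crd i)^-1, equal to 0 outside
   [local_dom f i j]. *)
Definition local_rep (f : S -> T) (i : idx A) (j : idx B) :
    'rV[R]_m -> 'rV[R]_n :=
  fun x => xget 0 [set y | exists p,
    [/\ dom i p, dom j (f p), crd i p = x & crd j (f p) = y]].

(* Openness of all the [local_dom f i j] expresses continuity of f. *)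
Definition smooth (f : S -> T) : Prop := forall i j,
  open (local_dom f i j) /\ smooth_on (local_dom f i j) (local_rep f i j).

End Maps.

(* A tangent vector is the family of its components in all the charts around
   its base point, related by the Jacobians of the changes of coordinates; by
   convention it has value 0 at the other charts, so that the tangent space at
   a point is a subset of one fixed R-module. *)
Definition tvec (R : realType) n T (A : atlas R n T) : lmodType R :=
  idx A -> 'rV[R]_n.

Definition tspace (R : realType) n T (A : atlas R n T) (p : T) : set (tvec A) :=
  [set v | (forall i, ~ dom i p -> v i = 0) /\
           (forall i j, dom i p -> dom j p ->
              v j = 'd (local_rep (A := A) (B := A) id i j) (crd i p) (v i))].

Arguments tspace {R n T} A p _.

(* The tangent map f_* at p; the value does not depend on the chart i. *)
Definition tmap (R : realType) m n S T (A : atlas R m S) (B : atlas R n T)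
    (f : S -> T) (p : S) (v : tvec A) : tvec B :=
  fun j => xget 0 [set w | exists i : idx A,
    [/\ dom i p, dom j (f p) & w = 'd (local_rep f i j) (crd i p) (v i)]].

Arguments tmap {R m n S T} A B f p v _.

Definition tbundle (R : realType) n T (A : atlas R n T) : Type :=
  {x : T * tvec A | tspace A x.1 x.2}.

Definition tb_pt (R : realType) n T (A : atlas R n T) (x : tbundle A) : T := (sval x).1.
Definition tb_vec (R : realType) n T (A : atlas R n T) (x : tbundle A) : tvec A := (sval x).2.

Definition tb_atlas (R : realType) n T (A : atlas R n T) : atlas R (n + n) (tbundle A) :=
  @Atlas R (n + n) _ (idx A)
    (fun i => @tb_pt _ _ _ A @^-1` dom i)
    (fun i x => row_mx (crd i (tb_pt x)) (tb_vec x i)).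

Definition linear_subspace (R : realType) (E : lmodType R) (V : set E) : Prop :=
  V 0 /\ forall (a : R) u v, V u -> V v -> V (a *: u + v).

Definition is_basis (R : realType) (E : lmodType R) (d : nat)
    (b : 'I_d -> E) (V : set E) : Prop :=
  (forall c : 'I_d -> R, V (\sum_l c l *: b l)) /\
  (forall v, V v -> exists! c : 'I_d -> R, v = \sum_l c l *: b l).

(* 0 when V is not a finite-dimensional subspace. *)
Definition vdim (R : realType) (E : lmodType R) (V : set E) : nat :=
  xget 0%N [set d | exists b : 'I_d -> E, is_basis b V].

Record manifold (R : realType) (n : nat) (T : topologicalType) := Manifold {
  charts :> atlas R n T;
  mfd_hausdorff : hausdorff_space T;
  mfd_second_countable : second_countable (T := T);
  chart_cover : forall p, exists i : idx charts, dom i p;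
  chart_dom_open : forall i : idx charts, open (dom i);
  chart_inj : forall i : idx charts, {in dom i &, injective (crd i)};
  chart_continuous : forall (i : idx charts) p, dom i p ->
    {for p, continuous (crd i)};
  chart_open : forall (i : idx charts) (U : set T),
    open U -> U `<=` dom i -> open (crd i @` U);
  chart_compatible : forall i j : idx charts,
    smooth_on (local_dom id i j) (local_rep id i j) }.

#[short(type="topologicalGroupCarrier")]
HB.structure Definition GroupTopological := {G of Group G & Topological G}.

Record lie_group (R : realType) (k : nat) (O : topologicalGroupCarrier) :=
  LieGroup {
  lie_manifold :> manifold R k O;
  lie_mul_smooth :
    smooth (prod_atlas lie_manifold lie_manifold) lie_manifold
      (fun ab : O * O => (ab.1 * ab.2)%g);
  lie_inv_smooth : smooth lie_manifold lie_manifold (fun a : O => a^-1%g) }.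

Definition lie_algebra (R : realType) k O (AO : lie_group R k O) :
  set (tvec AO) := tspace AO 1%g.
Arguments lie_algebra {R k O} AO _.

Section SSpace.
Context {R : realType} {n m k : nat}.
Context {M N : topologicalType} {O : topologicalGroupCarrier}.
Variables (AM : manifold R n M) (AN : manifold R m N) (AO : lie_group R k O).

Record s_space := SSpace {
  proj : N -> M;
  act : N -> O -> N;
  frame : 'I_n -> N -> tbundle AM;
  proj_smooth : smooth AN AM proj;
  proj_surj : forall p, exists z, proj z = p;
  proj_submersion : forall z,
    tmap AN AM proj z @` tspace AN z = tspace AM (proj z);
  act_smooth : smooth (prod_atlas AN AO) AN (fun za => act za.1 za.2);
  act1 : forall z, act z 1%g = z;
  actM : forall z a b, act (act z a) b = act z (a * b)%g;
  act_fiber : forall z a, proj (act z a) = proj z;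
  act_transitive : forall z z', proj z = proj z' -> exists a, act z a = z';
  frame_smooth : forall i, smooth AN (tb_atlas AM) (frame i);
  frame_pt : forall i z, tb_pt (frame i z) = proj z;
  frame_basis : forall z,
    is_basis (fun i => tb_vec (frame i z)) (tspace AM (proj z));
  rigid_base_change : exists L : O -> 'M[R]_n,
    [/\ smooth AO (euclid R (n * n)) (fun a => mxvec (L a)),
        forall a, L a \in unitmx,
        forall a b, L (a * b)%g = L a *m L b &
        forall z a i,
          tb_vec (frame i (act z a)) = \sum_l L a l i *: tb_vec (frame l z)] }.

Variable lam : s_space.

Definition stabilizer (z : N) : set O := [set a | act lam z a = z].

(* T_e S_z inside T_e O: the velocities at e of the smooth curves in O that
   pass through e and stay in the closed (hence embedded Lie) subgroup S_z. *)
Definition stabilizer_tspace (z : N) : set (tvec AO) :=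
  [set v | exists c : 'rV[R]_1 -> O,
     [/\ smooth (euclid R 1) AO c, c 0 = 1%g, forall t, stabilizer z (c t) &
         v = tmap (euclid R 1) AO c 0 (fun _ => const_mx 1)]].

(* The common value of dim S_z, z in N (0 if N is empty). *)
Definition stabilizer_dim : nat :=
  xget 0%N [set vdim (stabilizer_tspace z) | z in [set: N]].

Definition vertical (z : N) : set (tvec AN) :=
  tspace AN z `&` [set v | tmap AN AM (proj lam) z v = 0].

(* Componentwise in each chart; row vectors, so the endomorphism acts by
   right multiplication.  Fiberwise linearity is part of the definition. *)
Definition tensor11 (phi : N -> tvec AN -> tvec AN) : Prop :=
  (forall z v, tspace AN z v -> tspace AN z (phi z v)) /\
  (forall i : idx AN, exists A : 'rV[R]_m -> 'M[R]_m,
     smooth_on (crd i @` dom i) A /\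
     forall z v, dom i z -> tspace AN z v -> phi z v i = v i *m A (crd i z)).

Definition connection (phi : N -> tvec AN -> tvec AN) : Prop :=
  [/\ tensor11 phi,
      forall z v, tspace AN z v -> vertical z (phi z v),
      forall z v, tspace AN z v -> phi z (phi z v) = phi z v,
      forall z v, vertical z v -> phi z v = v &
      forall z a v, tspace AN z v ->
        phi (act lam z a) (tmap AN AN (act lam ^~ a) z v) =
        tmap AN AN (act lam ^~ a) z (phi z v)].

End SSpace.

Definition trivial_tangent_bundle (R : realType) (m : nat)
    (N : topologicalType) (AN : manifold R m N) : Prop :=
  exists (F : tbundle AN -> N * 'rV[R]_m) (G : N * 'rV[R]_m -> tbundle AN),
    [/\ cancel F G /\ cancel G F,
        smooth (tb_atlas AN) (prod_atlas AN (euclid R m)) F,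
        smooth (prod_atlas AN (euclid R m)) (tb_atlas AN) G,
        forall x, (F x).1 = tb_pt x &
        forall (a : R) x y w, tb_pt x = tb_pt w -> tb_pt y = tb_pt w ->
          tb_vec w = a *: tb_vec x + tb_vec y ->
          (F w).2 = a *: (F x).2 + (F y).2].

(* Main.v *)
From HB Require Import structures.
Require Import Defs.
From mathcomp Require Import all_boot all_order all_algebra.
From mathcomp Require Import all_classical all_reals all_analysis.
From mathcomp Require Import ring lra.
Import Order.TTheory GRing.Theory Num.Theory numFieldNormedType.Exports.

(** The tangent bundle of N is trivialized by a global frame made of two groups
    of vector fields.

    Horizontal fields.  The connection phi splits each tangent space of N into
    the vertical space and the kernel of phi, and the derivative of the
    projection psi maps that kernel isomorphically onto the tangent space of M.
    Lifting e_1(z), ..., e_n(z) gives n independent fields; they are smooth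
    because the lift is given, in charts, by a formula that is rational in the
    components of the e_i, the Jacobian of psi and the matrix of phi
    ([smooth_horizontal_frame]).

    Vertical fields.  A basis b_1, ..., b_d of V gives the fundamental fields
    z |-> d/dt z.exp(t b_l), that is, the images of the b_l under the derivative
    at 1 of the orbit map a |-> z.a.  They are tangent to the fibers, and they
    are independent: a combination that vanishes at z comes from a vector v of V
    killed by the derivative of the orbit map, such a v is tangent to the
    stabilizer of z ([stabilizer_tspaceP]), hence v = 0 by hypothesis.

    It remains to see that the number d = k - s of vertical fields is the
    dimension m - n of the fibers.  The kernel of the derivative of the orbit
    map at 1 is the tangent space of the stabilizer, so k - s is the rank of
    that derivative, and one has to prove that this rank is m - n
    ([rank_orbit]).  By equivariance the orbit map has constant rank r; if r were
    less than m - n, its image, which is the whole fiber by transitivity, would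
    be a countable union of r-dimensional pieces (O is second countable), while
    an affine map sends a part of the fiber onto a ball of dimension m - n.
    Baire's theorem excludes this, as a Lipschitz image of an r-dimensional ball
    is nowhere dense in higher dimension ([lipschitz_image_nowhere_dense]).

    Both facts on orbit maps rest on the constant rank theorem
    ([constant_rank]), deduced from the inverse function theorem
    ([local_inverse]).  It replaces the exponential map of O: a curve in the
    stabilizer with given velocity is obtained as a curve in a level set of a
    map of constant rank ([level_curve]), without solving a differential
    equation.

    Vectors are rows and matrices act on the right, so the Jacobian of a
    composite is the product of the Jacobians in the order in which the maps are
    applied. *)

Set Implicit Arguments.
Unset Strict Implicit.
Unset Printing Implicit Defensive.

Local Open Scope classical_set_scope.
Local Open Scope ring_scope.

(** * Differentiability *)

Section Differentials.
Context {R : realType}.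

(** The epsilon form of differentiability, for a candidate differential L; maps
    that are not built by the usual rules, such as local inverses, are
    differentiated through it. *)
Lemma is_diff_eps (V W : normedModType R) (f : V -> W) (x : V)
    (L : {linear V -> W}) : continuous L ->
  (forall e, 0 < e -> \forall y \near x, `|f y - f x - L (y - x)| <= e * `|y - x|) ->
  is_diff x f L.
Proof.
move=> Lc H.
have E : f \o shift x = cst (f x) + L +o_ 0 id.
  apply/eqaddoE/eqaddoP => e e0.
  have := H e e0; rewrite (near_shift 0 x) => H'.
  apply: filterS H' => y /=.
  by rewrite !subr0 addrK !fctE /= opprD addrA.
have dE := diff_unique Lc E.
by apply: DiffDef => //; apply/diff_locallyP; rewrite dE.
Qed.

Lemma diff_eps (V W : normedModType R) (f : V -> W) (x : V) :
  differentiable f x ->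
  forall e, 0 < e -> \forall y \near x,
    `|f y - f x - 'd f x (y - x)| <= e * `|y - x|.
Proof.
move=> /diff_locally /eqaddoP E e e0.
rewrite (near_shift 0 x); apply: filterS (E e e0) => y /=.
by rewrite !fctE /= !subr0 addrK opprD addrA.
Qed.

Lemma near_eq_is_diff (V W : normedModType R) (f g : V -> W) (x : V) :
  (\forall y \near x, f y = g y) -> differentiable f x -> is_diff x g ('d f x).
Proof.
move=> fg df; apply: is_diff_eps; first exact: diff_continuous.
move=> e e0; have := diff_eps df e0.
have fgx := nbhs_singleton fg.
by apply: filterS2 fg => y -> H; rewrite -fgx.
Qed.

End Differentials.

(** * Calculus of smooth maps *)

Section ContDiff.
Context {R : realType}.
Implicit Types V W : normedModType R.

Lemma cont_diff_sub V W k (U U' : set V) (f : V -> W) :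
  U' `<=` U -> cont_diff k U f -> cont_diff k U' f.
Proof.
move=> sU; elim: k f => [|k IH] f /= H; first by move=> x /sU; exact: H.
by have [H1 H2] := H; split=> [x /sU|v]; [exact: H1|exact/IH/H2].
Qed.

Lemma cont_diff_pred V W k (U : set V) (f : V -> W) :
  cont_diff k.+1 U f -> cont_diff k U f.
Proof.
elim: k f => [|k IH] f [H1 H2].
  by move=> x Ux; apply: differentiable_continuous; exact: H1.
by split => // v; exact/IH/H2.
Qed.

(** On an open set the derivatives of all orders depend only on the values in
    that set. *)
Lemma cont_diff_ext V W k (U : set V) (f g : V -> W) :
  open U -> {in U, f =1 g} -> cont_diff k U f -> cont_diff k U g.
Proof.
move=> oU; elim: k f g => [|k IH] f g fg /=.
  move=> H x Ux; rewrite /prop_for /continuous_at -(fg _ (mem_set Ux)).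
  apply: cvg_trans (H x Ux); apply: near_eq_cvg.
  by apply: filterS (open_nbhs_nbhs (conj oU Ux)) => y /mem_set /fg.
have nfg x : U x -> \forall y \near x, f y = g y.
  move=> Ux; apply: filterS (open_nbhs_nbhs (conj oU Ux)) => y.
  by move=> /mem_set /fg.
move=> [H1 H2]; split=> [x Ux|v].
  by have [] := near_eq_is_diff (nfg x Ux) (H1 x Ux).
apply: IH (H2 v) => x; rewrite inE => Ux.
exact/near_eq_derive/nfg.
Qed.

(** Coordinate expressions are given by different formulas on different pieces
    of their domain; smoothness is checked piece by piece. *)
Lemma cont_diff_local V W k (U : set V) (f : V -> W) :
  (forall x, U x -> exists2 U', U' x & cont_diff k U' f) -> cont_diff k U f.
Proof.
elim: k f => [|k IH] f /= H.
  by move=> x /H[U' U'x]; exact.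
split=> [x /H[U' U'x [H1 _]]|v]; first exact: H1.
by apply: IH => x /H[U' U'x [_ H2]]; exists U'.
Qed.

Lemma cont_diff_cst V W k (U : set V) (c : W) : cont_diff k U (fun=> c).
Proof.
elim: k c => [|k IH] c /=; first by move=> x _; exact: cst_continuous.
split=> [x _|v]; first exact: differentiable_cst.
by under eq_fun do rewrite derive_cst.
Qed.

Lemma cont_diff_id V k (U : set V) : cont_diff k U id.
Proof.
case: k => [|k] /=; first by move=> x _; exact: cvg_id.
split=> [x _|v]; first exact: ex_diff.
by under eq_fun do rewrite derive_id; exact: cont_diff_cst.
Qed.

Lemma cont_diff_add V W k (U : set V) (f g : V -> W) : open U ->
  cont_diff k U f -> cont_diff k U g -> cont_diff k U (fun x => f x + g x).
Proof.
move=> oU; elim: k f g => [|k IH] f g.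
  by move=> /= H1 H2 x Ux; apply: continuousD; [exact: H1|exact: H2].
move=> [f1 f2] [g1 g2]; split=> [x Ux|v].
  by apply: differentiableD; [exact: f1|exact: g1].
apply: cont_diff_ext (IH _ _ (f2 v) (g2 v)) => // x; rewrite inE => Ux.
by rewrite (@deriveD _ _ _ f g)//; apply: diff_derivable; [exact: f1|exact: g1].
Qed.

Lemma cont_diff_mul V k (U : set V) (f g : V -> R) : open U ->
  cont_diff k U f -> cont_diff k U g -> cont_diff k U (fun x => f x * g x).
Proof.
move=> oU; elim: k f g => [|k IH] f g.
  by move=> /= H1 H2 x Ux; exact: (continuousM (H1 _ Ux) (H2 _ Ux)).
move=> fd gd; have [f1 f2] := fd; have [g1 g2] := gd; split=> [x Ux|v].
  by apply: differentiableM; [exact: f1|exact: g1].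
apply: (@cont_diff_ext _ _ _ _ (fun x => f x * 'D_v g x + g x * 'D_v f x)).
- by [].
- move=> x; rewrite inE => Ux.
  by rewrite (@deriveM _ _ f g)//; apply: diff_derivable; [exact: f1|exact: g1].
- have fk := cont_diff_pred fd; have gk := cont_diff_pred gd.
  by apply: cont_diff_add => //; apply: IH => //; [exact: g2|exact: f2].
Qed.

Lemma cont_diff_inv V k (U : set V) (f : V -> R) : open U ->
  (forall x, U x -> f x != 0) ->
  cont_diff k U f -> cont_diff k U (fun x => (f x)^-1).
Proof.
move=> oU f0; elim: k => [|k IH].
  by move=> /= H x Ux; exact: (continuousV (f0 _ Ux) (H _ Ux)).
move=> fd; have [f1 f2] := fd; split=> [x Ux|v].
  by apply: differentiableV; [exact: f1|exact: f0].
have fk := IH (cont_diff_pred fd).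
apply: (@cont_diff_ext _ _ _ _ (fun x => (-1 * (f x)^-1 * (f x)^-1) * 'D_v f x)).
- by [].
- move=> x; rewrite inE => Ux.
  rewrite (@deriveV _ _ f)//; [|exact: f0|exact/diff_derivable/f1].
  by rewrite expr2 invfM scaleNr mulN1r !mulNr.
- apply: cont_diff_mul; [by []| |exact: f2].
  by do 2![apply: cont_diff_mul => //]; exact: cont_diff_cst.
Qed.

Lemma cont_diff_sum V W k (U : set V) (I : Type) (r : seq I)
    (F : I -> V -> W) : open U ->
  (forall i, cont_diff k U (F i)) ->
  cont_diff k U (fun x => \sum_(i <- r) F i x).
Proof.
move=> oU H; elim: r => [|i r IH].
  by under eq_fun do rewrite big_nil; exact: cont_diff_cst.
by under eq_fun do rewrite big_cons; exact: cont_diff_add.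
Qed.

Lemma cont_diff_prod V k (U : set V) (I : Type) (r : seq I)
    (F : I -> V -> R) : open U ->
  (forall i, cont_diff k U (F i)) ->
  cont_diff k U (fun x => \prod_(i <- r) F i x).
Proof.
move=> oU H; elim: r => [|i r IH].
  by under eq_fun do rewrite big_nil; exact: cont_diff_cst.
by under eq_fun do rewrite big_cons; exact: cont_diff_mul.
Qed.

Lemma differentiable_mxP V p q (F : V -> 'M[R]_(p, q)) x :
  differentiable F x <-> forall i j, differentiable (fun y => F y i j) x.
Proof.
split=> [dF i j|H].
  exact: (@differentiable_comp _ _ _ _ F (fun M : 'M[R]_(p, q) => M i j : R) x
    dF (differentiable_coord _ _ _)).
rewrite (_ : F = \sum_(i < p) \sum_(j < q) (fun y => F y i j *: delta_mx i j)).
  by do 2![apply: differentiable_sum => ?]; exact: differentiableZl.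
apply/funext => y; rewrite fct_sumE [LHS]matrix_sum_delta.
by apply: eq_bigr => i _; rewrite fct_sumE.
Qed.

(** Reduces matrix-valued maps to scalar ones, for which there are products and
    inverses. *)
Lemma cont_diff_mx V p q k (U : set V) (F : V -> 'M[R]_(p, q)) : open U ->
  cont_diff k U F <-> forall i j, cont_diff k U (fun x => F x i j).
Proof.
move=> oU; elim: k F => [|k IH] F.
  split=> /= [H i j x Ux|H x Ux].
    exact: (continuous_comp (H x Ux) (@coord_continuous _ _ _ i j _)).
  apply/cvgrPdist_lt => e e0.
  have : \forall y \near x, forall ij : 'I_p * 'I_q,
      `|F x ij.1 ij.2 - F y ij.1 ij.2| < e.
    apply: filter_forall => -[i j] /=.
    by have /cvgrPdist_lt := H i j x Ux; exact.
  apply: filterS => y Hy.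
  rewrite [ltLHS]/Num.Def.normr/= mx_normrE; apply/bigmax_ltP; split=> //= ij _.
  by rewrite !mxE; exact: Hy.
have dE : (forall x, U x -> differentiable F x) -> forall v i j x, U x ->
    ('D_v F x) i j = 'D_v (fun y => F y i j) x.
  by move=> dF v i j x Ux; rewrite derive_mx ?mxE//; exact/diff_derivable/dF.
split=> [[H1 H2] i j|H].
  split=> [x Ux|v]; first by have /differentiable_mxP := H1 x Ux.
  have /IH/(_ i j) := H2 v.
  by apply: cont_diff_ext => // x; rewrite inE; exact: dE.
have dF x : U x -> differentiable F x.
  by move=> Ux; apply/differentiable_mxP => i j; have [H1 _] := H i j; exact: H1.
split=> // v; apply/IH => i j; have [_ /(_ v)] := H i j.
by apply: cont_diff_ext => // x; rewrite inE => Ux; rewrite dE.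
Qed.

Lemma cont_diff_lsubmx n q k (U : set 'rV[R]_(n + q)) : open U ->
  cont_diff k U (fun y => lsubmx y : 'rV[R]_n).
Proof.
move=> oU; apply/cont_diff_mx => // i j; under eq_fun do rewrite mxE.
by apply: (cont_diff_mx _ id oU).1; exact: cont_diff_id.
Qed.

Lemma cont_diff_rsubmx n q k (U : set 'rV[R]_(n + q)) : open U ->
  cont_diff k U (fun y => rsubmx y : 'rV[R]_q).
Proof.
move=> oU; apply/cont_diff_mx => // i j; under eq_fun do rewrite mxE.
by apply: (cont_diff_mx _ id oU).1; exact: cont_diff_id.
Qed.

Lemma cont_diff_row_mx V p n q k (U : set V)
    (f : V -> 'M[R]_(p, n)) (g : V -> 'M[R]_(p, q)) : open U ->
  cont_diff k U f -> cont_diff k U g -> cont_diff k U (fun x => row_mx (f x) (g x)).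
Proof.
move=> oU /(cont_diff_mx _ _ oU).1 cf /(cont_diff_mx _ _ oU).1 cg.
apply/cont_diff_mx => // i j; case: (split_ordP j) => l ->.
  by under eq_fun do rewrite row_mxEl; exact: cf.
by under eq_fun do rewrite row_mxEr; exact: cg.
Qed.

Lemma cont_diff_col_mx V p q r k (U : set V)
    (f : V -> 'M[R]_(p, r)) (g : V -> 'M[R]_(q, r)) : open U ->
  cont_diff k U f -> cont_diff k U g -> cont_diff k U (fun x => col_mx (f x) (g x)).
Proof.
move=> oU /(cont_diff_mx _ _ oU).1 cf /(cont_diff_mx _ _ oU).1 cg.
apply/cont_diff_mx => // i j; case: (split_ordP i) => l ->.
  by under eq_fun do rewrite col_mxEu; exact: cf.
by under eq_fun do rewrite col_mxEd; exact: cg.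
Qed.

Lemma diff_row p (W : normedModType R) (g : 'rV[R]_p -> W) y v :
  differentiable g y ->
  'd g y v = \sum_j v 0 j *: 'D_(delta_mx 0 j) g y.
Proof.
move=> dg; rewrite [in LHS](row_sum_delta v) linear_sum.
by apply: eq_bigr => j _; rewrite linearZ deriveE.
Qed.

(** By the chain rule the derivative of the composite is a finite sum of products
    of a coordinate of 'D_v f with a partial derivative of g composed with f; the
    induction on k applies to the latter. *)
Lemma cont_diff_comp V p q r k (U : set V) (U' : set 'rV[R]_p)
    (f : V -> 'rV[R]_p) (g : 'rV[R]_p -> 'M[R]_(q, r)) :
  open U -> open U' -> (forall x, U x -> U' (f x)) ->
  cont_diff k U f -> cont_diff k U' g -> cont_diff k U (fun x => g (f x)).
Proof.
move=> oU oU' UU'; elim: k g => [|k IH] g.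
  move=> /= H1 H2 x Ux; apply: continuous_comp; first exact: H1.
  exact/H2/UU'.
move=> fd gd; have [f1 f2] := fd; have [g1 g2] := gd; split=> [x Ux|v].
  by apply: differentiable_comp; [exact: f1|exact/g1/UU'].
apply: (@cont_diff_ext _ _ _ _
  (fun x => \sum_j ('D_v f x) 0 j *: 'D_(delta_mx 0 j) g (f x))).
- by [].
- move=> x; rewrite inE => Ux.
  have dgf : differentiable (fun x => g (f x)) x.
    by apply: differentiable_comp; [exact: f1|exact/g1/UU'].
  rewrite [RHS]deriveE// (@diff_comp _ _ _ _ f g); [|exact: f1|exact/g1/UU'].
  have /= <- : 'D_v f x = 'd f x v by rewrite deriveE//; exact: f1.
  by rewrite diff_row//; exact/g1/UU'.
- apply: cont_diff_sum => // j; apply/cont_diff_mx => // a b.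
  have := f2 v => /(cont_diff_mx _ _ oU).1 /(_ 0 j) f2j.
  have := IH _ (cont_diff_pred fd) (g2 (delta_mx 0 j)).
  move=> /(cont_diff_mx _ _ oU).1/(_ a b) gj.
  have := cont_diff_mul oU f2j gj.
  by apply: cont_diff_ext => // x _; rewrite !mxE.
Qed.

Lemma cont_diff_mulmx V p q r k (U : set V) (A : V -> 'M[R]_(p, q))
    (B : V -> 'M[R]_(q, r)) : open U ->
  cont_diff k U A -> cont_diff k U B -> cont_diff k U (fun x => A x *m B x).
Proof.
move=> oU /(cont_diff_mx _ _ oU).1 HA /(cont_diff_mx _ _ oU).1 HB.
apply/cont_diff_mx => // i j; under eq_fun do rewrite mxE.
by apply: cont_diff_sum => // l; exact: cont_diff_mul.
Qed.

Lemma cont_diff_det V p k (U : set V) (A : V -> 'M[R]_p) : open U ->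
  cont_diff k U A -> cont_diff k U (fun x => \det (A x)).
Proof.
move=> oU /(cont_diff_mx _ _ oU).1 HA; rewrite /determinant.
apply: cont_diff_sum => // s; apply: cont_diff_mul => //.
  exact: cont_diff_cst.
by apply: cont_diff_prod.
Qed.

(** The entries of the inverse are the cofactors divided by the determinant. *)
Lemma cont_diff_invmx V p k (U : set V) (A : V -> 'M[R]_p) : open U ->
  (forall x, U x -> A x \in unitmx) ->
  cont_diff k U A -> cont_diff k U (fun x => invmx (A x)).
Proof.
move=> oU uA HA.
apply: (@cont_diff_ext _ _ _ _ (fun x => (\det (A x))^-1 *: \adj (A x))) => //.
  by move=> x; rewrite inE => /uA; rewrite /invmx => ->.
apply/cont_diff_mx => // i j; under eq_fun do rewrite mxE.
apply: cont_diff_mul => //.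
  apply: cont_diff_inv => //; last exact: cont_diff_det.
  by move=> x /uA; rewrite unitmxE unitfE.
under eq_fun do rewrite mxE; apply: cont_diff_mul => //.
  exact: cont_diff_cst.
apply: cont_diff_det => //; apply/cont_diff_mx => // a b.
under eq_fun do rewrite !mxE.
by move: HA => /(cont_diff_mx _ _ oU).1; exact.
Qed.

Lemma open_unitmx V p (U : set V) (A : V -> 'M[R]_p) : open U ->
  cont_diff 0 U A -> open (U `&` [set x | A x \in unitmx]).
Proof.
move=> oU HA; rewrite openE => x [Ux uAx].
apply: filterI; first exact: open_nbhs_nbhs.
have := cont_diff_det oU HA; move=> /(_ x Ux) /(_ [set d | d != 0]) H.
have : nbhs x ((fun x => \det (A x)) @^-1` [set d | d != 0]).
  apply: H; apply: open_nbhs_nbhs; split; last by rewrite /= -unitfE -unitmxE.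
  exact: open_neq.
by apply: filterS => y /=; rewrite unitmxE unitfE.
Qed.

End ContDiff.

(** * Mean value inequality and strict differentiability *)

Section MeanValue.
Context {R : realType}.

Lemma is_diff_line (V : normedModType R) (x v : V) (t : R) :
  is_diff t (fun s : R => x + s *: v) (fun s => s *: v).
Proof.
have H1 : is_diff t (cst x + ( *:%R^~ v)) (0 + ( *:%R^~ v)) by exact: is_diffD.
by apply: is_diff_eq H1 _; rewrite add0r.
Qed.

(** The intermediate point depends on the coordinate j, hence the coordinatewise
    form. *)
Lemma mean_value (V : normedModType R) q (f : V -> 'rV[R]_q) (x v : V) j :
  (forall t : R, 0 <= t <= 1 -> differentiable f (x + t *: v)) ->
  exists2 t : R, 0 <= t <= 1 & (f (x + v) - f x) 0 j = ('d f (x + t *: v) v) 0 j.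
Proof.
move=> df; pose F (t : R) := f (x + t *: v).
have dF (t : R) : 0 <= t <= 1 -> is_diff t F (fun s => 'd f (x + t *: v) (s *: v)).
  move=> /df dft; have dl := is_diff_line x v t.
  have : is_diff t (f \o (fun s : R => x + s *: v))
     ('d f (x + t *: v) \o (fun s => s *: v)).
    by apply: is_diff_comp => //; exact: differentiableP.
  by [].
have dphi (t : R) : 0 <= t <= 1 -> differentiable (fun s => F s 0 j : R) t.
  by move=> /dF dt; have /differentiable_mxP := @ex_diff _ _ _ _ _ _ _ dt; exact.
have [||t t01] := @MVT _ (fun t => F t 0 j) (fun t => ('d f (x + t *: v) v) 0 j) 0 1 ltr01.
- move=> t; rewrite in_itv /= => /andP[t0 t1].
  have t01 : 0 <= t <= 1 by rewrite !ltW.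
  apply: DeriveDef; first exact/diff_derivable/dphi.
  have dt := dF _ t01; have dFt := @ex_diff _ _ _ _ _ _ _ dt.
  have dv : derivable F t 1 by exact: diff_derivable.
  have := derive_mx dv.
  move=> /(congr1 (fun M : 'rV__ => M 0 j)); rewrite mxE => <-.
  by rewrite deriveE// diff_val scale1r.
- apply: continuous_in_subspaceT => t; rewrite inE /= in_itv /= => /dphi dt.
  exact: differentiable_continuous.
rewrite /F scale0r scale1r addr0 subr0 mulr1 => E.
exists t; first by move: t01; rewrite in_itv /= => /andP[/ltW -> /ltW ->].
by rewrite -E !mxE.
Qed.

Lemma constant_along (V : normedModType R) q (f : V -> 'rV[R]_q) (x v : V) :
  (forall t : R, 0 <= t <= 1 ->
    differentiable f (x + t *: v) /\ 'd f (x + t *: v) v = 0) ->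
  f (x + v) = f x.
Proof.
move=> H; apply/subr0_eq/rowP => j.
have [t /H[_ d0] ->] := @mean_value _ _ f x v j (fun t t01 => (H t t01).1).
by rewrite d0.
Qed.

Lemma mul_jacobian p q (f : 'rV[R]_p -> 'rV[R]_q) x v :
  v *m 'J f x = 'd f x v.
Proof. by rewrite /jacobian mul_rV_lin1. Qed.

Lemma jacobianP p q (f : 'rV[R]_p -> 'rV[R]_q) x (L : 'rV[R]_p -> 'rV[R]_q) M :
  is_diff x f L -> (forall v, L v = v *m M) -> 'J f x = M.
Proof.
move=> fL LM; apply/row_matrixP => i.
by rewrite !rowE mul_jacobian -LM (@diff_val _ _ _ _ _ _ _ fL).
Qed.

Lemma cont_diff_jacobian p q k (U : set 'rV[R]_p) (f : 'rV[R]_p -> 'rV[R]_q) :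
  open U -> cont_diff k.+1 U f -> cont_diff k U (fun x => 'J f x).
Proof.
move=> oU [f1 f2]; apply/cont_diff_mx => // i j.
have /(cont_diff_mx _ _ oU).1/(_ 0 j) := f2 (delta_mx 0 i).
apply: cont_diff_ext => // x; rewrite inE => Ux.
by rewrite deriveE ?mxE//; exact: f1.
Qed.

Lemma norm_coord p q (M : 'M[R]_(p, q)) i j : `|M i j| <= `|M|.
Proof.
rewrite [leRHS]/Num.Def.normr/= mx_normrE.
exact: (le_bigmax _ (fun ij => `|M ij.1 ij.2|) (i, j)).
Qed.

Lemma norm_mx_le p q (M : 'M[R]_(p, q)) (c : R) : 0 <= c ->
  (forall i j, `|M i j| <= c) -> `|M| <= c.
Proof.
move=> c0 H; rewrite [leLHS]/Num.Def.normr/= mx_normrE.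
by apply/bigmax_leP; split.
Qed.

Lemma norm_mulmx_le p q r (A : 'M[R]_(p, q)) (B : 'M[R]_(q, r)) :
  `|A *m B| <= q%:R * `|A| * `|B|.
Proof.
apply: norm_mx_le => [|i j]; first by rewrite !mulr_ge0.
rewrite mxE (le_trans (ler_norm_sum _ _ _))//.
have -> : q%:R * `|A| * `|B| = \sum_(l < q) `|A| * `|B|.
  by rewrite sumr_const card_ord -mulrA mulr_natl.
apply: ler_sum => l _; rewrite normrM.
by apply: ler_pM => //; exact: norm_coord.
Qed.

Lemma ball_normP (V : normedModType R) (x y : V) (r : R) :
  ball x r y <-> `|y - x| < r.
Proof. by rewrite -ball_normE /= distrC. Qed.

Lemma ball_segment (V : normedModType R) (x0 x v : V) (d t : R) :
  ball x0 d x -> ball x0 d (x + v) -> 0 <= t <= 1 -> ball x0 d (x + t *: v).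
Proof.
rewrite -ball_normE /= => Bx By /andP[t0 t1].
have -> : x0 - (x + t *: v) = (1 - t) *: (x0 - x) + t *: (x0 - (x + v)).
  have E w : x0 - (x + w) = x0 - x - w by rewrite opprD addrA.
  by rewrite !E; move: (x0 - x) => a; rewrite scalerBl scale1r scalerBr addrA subrK.
rewrite (le_lt_trans (ler_normD _ _))// !normrZ !ger0_norm ?subr_ge0//.
have [->|tn0] := eqVneq t 0; first by rewrite subr0 mul1r mul0r addr0.
have t00 : 0 < t by rewrite lt_def tn0.
have : (1 - t) * `|x0 - x| <= (1 - t) * d by rewrite ler_wpM2l ?subr_ge0// ltW.
have : t * `|x0 - (x + v)| < t * d by rewrite ltr_pM2l.
lra.
Qed.

(** Continuous differentiability makes a function strictly differentiable: the
    linear approximation at x0 is uniform over pairs of points near x0. *)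
Lemma strict_diff p q (U : set 'rV[R]_p) (f : 'rV[R]_p -> 'rV[R]_q) x0 (e : R) :
  open U -> cont_diff 1 U f -> U x0 -> 0 < e ->
  exists2 d : R, 0 < d & ball x0 d `<=` U /\
    forall x y, ball x0 d x -> ball x0 d y ->
      `|f y - f x - (y - x) *m 'J f x0| <= e * `|y - x|.
Proof.
move=> oU fU Ux0 e0.
have cJ := cont_diff_jacobian oU fU.
pose e' := e / p.+1%:R; have e'0 : 0 < e' by rewrite divr_gt0.
have /cvgrPdist_le/(_ e' e'0) H := cJ x0 Ux0.
have : \forall x \near x0, U x /\ `|'J f x0 - 'J f x| <= e'.
  by apply: filterI H; exact: open_nbhs_nbhs.
move=> /nbhs_ballP[d /= d0 Hd]; exists d => //; split=> [x /Hd[]//|x y Bx By].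
have Bt (t : R) : 0 <= t <= 1 -> ball x0 d (x + t *: (y - x)).
  by apply: ball_segment; rewrite ?subrKC.
apply: norm_mx_le => [|i j]; first by rewrite mulr_ge0// ltW.
rewrite ord1 {i}.
have [t /Bt Bxt] := @mean_value _ _ f x (y - x) j
  (fun t t01 => fU.1 _ (Hd _ (Bt t t01)).1).
rewrite subrKC => E; have [_ HJ] := Hd _ Bxt.
have -> : (f y - f x - (y - x) *m 'J f x0) 0 j =
   - ((y - x) *m ('J f x0 - 'J f (x + t *: (y - x)))) 0 j.
  have K (a b c : 'rV[R]_q) : c 0 j = a 0 j -> (c - b) 0 j = - (b - a) 0 j.
    by rewrite !mxE => ->; rewrite opprB.
  by rewrite mulmxBr; apply: K; rewrite mul_jacobian.
rewrite normrN (le_trans (norm_coord _ _ _))// (le_trans (norm_mulmx_le _ _))//.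
rewrite mulrAC ler_wpM2r//.
have : p%:R * e' <= e.
  rewrite /e' mulrCA -[leRHS]mulr1 (ler_wpM2l (ltW e0))// ler_pdivrMr// mul1r.
  by rewrite ler_nat.
by apply: le_trans; rewrite ler_wpM2l.
Qed.

End MeanValue.

(** * The inverse function theorem *)

Section LocalInverse.
Context {R : realType}.

Lemma mulmxr_continuous p q (M : 'M[R]_(p, q)) :
  continuous (mulmxr M : 'rV[R]_p -> 'rV[R]_q).
Proof.
move=> x; have := @cont_diff_mulmx R 'rV[R]_p 1 p q 0 setT id (fun=> M) openT
  (cont_diff_id _ _) (cont_diff_cst _ _ _).
by move=> /(_ x I).
Qed.

Lemma norm_mulmx_bound p q (M : 'M[R]_(p, q)) :
  exists2 C : R, 0 < C & forall u : 'rV[R]_p, `|u *m M| <= C * `|u|.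
Proof.
exists (p%:R * `|M| + 1); first by rewrite ltr_wpDl ?mulr_ge0.
move=> u; rewrite (le_trans (norm_mulmx_le _ _))// mulrAC.
by rewrite mulrDl lerDl mul1r.
Qed.

Lemma contraction_fixpoint p (x0 : 'rV[R]_p) (r : R) (T : 'rV[R]_p -> 'rV[R]_p) :
  0 <= r ->
  (forall x, `|x - x0| <= r -> `|T x - x0| <= r) ->
  (forall x y, `|x - x0| <= r -> `|y - x0| <= r ->
     `|T x - T y| <= 2^-1 * `|x - y|) ->
  exists2 x, `|x - x0| <= r & T x = x.
Proof.
move=> r0 TB Tc.
(* Completeness and the norm of row vectors, joined in one structure. *)
pose X : completeNormedModType R := HB.pack_for (completeNormedModType R) 'rV[R]_p.
pose B : set X := closed_ball_ Num.Def.normr (x0 : X) r.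
have BE (x : X) : B x <-> `|x - x0| <= r.
  by rewrite /B /closed_ball_ /= distrC.
have hB : {homo (T : X -> X) : x / B x >-> B x} by move=> x /BE /TB /BE.
have ctr : is_contraction (mkfun_fun hB).
  exists (2^-1)%:nng; split; first by rewrite /= invf_lt1// ltr1n.
  by move=> [x y] [/= /BE Bx /BE By]; exact: Tc.
have clB : closed B by exact: closed_closed_ball_.
have B0 : B !=set0 by exists x0; apply/BE; rewrite subrr normr0.
have [x /BE Bx Tx] := banach_fixed_point ctr clB B0.
by exists x.
Qed.

(** The inverse function theorem.  Newton's map with frozen Jacobian is a
    contraction, which gives the inverse h; the formula for its derivative then
    propagates differentiability of h to all orders. *)
Lemma local_inverse p (U : set 'rV[R]_p) (f : 'rV[R]_p -> 'rV[R]_p) x0 :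
  open U -> smooth_on U f -> U x0 -> 'J f x0 \in unitmx ->
  exists d rho h, [/\ 0 < d, 0 < rho,
    ball x0 d `<=` U `&` [set x | 'J f x \in unitmx],
    smooth_on (ball (f x0) rho) h &
    (forall y, ball (f x0) rho y ->
       [/\ ball x0 d (h y), f (h y) = y &
           is_diff y h (fun v => v *m invmx ('J f (h y)))]) /\
    (forall x, ball x0 d x -> ball (f x0) rho (f x) -> h (f x) = x)].
Proof.
move=> oU sf Ux0 uA; set A := 'J f x0 in uA *; pose B := invmx A.
have [C C0 HC] := norm_mulmx_bound B.
(* With this e, the inverse of the frozen Jacobian turns the error of the linear
   approximation into at most half the distance of the two points. *)
pose e := (2 * C)^-1; have e0 : 0 < e by rewrite invr_gt0 mulr_gt0.
pose U1 := U `&` [set x | 'J f x \in unitmx].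
have cJ k : cont_diff k U (fun x => 'J f x) by apply: cont_diff_jacobian.
have oU1 : open U1 by exact: open_unitmx.
have [||d0 d00 [d0U est]] := @strict_diff R p p U1 f x0 e oU1 _ _ e0.
- by apply: cont_diff_sub (sf 1%N) => x [].
- by split.
have eC : C * e = 2^-1 by rewrite /e invfM mulrCA mulfV ?mulr1// gt_eqF.
have est' x y : ball x0 d0 x -> ball x0 d0 y ->
    `|(y - x) - (f y - f x) *m B| <= 2^-1 * `|y - x|.
  move=> Bx By; have := est x y Bx By.
  have -> : y - x - (f y - f x) *m B = - ((f y - f x - (y - x) *m A) *m B).
    by rewrite [in RHS]mulmxBl -[(y - x) *m A *m B]mulmxA mulmxV// mulmx1 opprB.
  move=> H; rewrite normrN (le_trans (HC _))// -eC -mulrA.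
  by rewrite ler_pM2l.
(* f expands distances by at least (2 C)^-1: this is injectivity, and it makes
   h Lipschitz. *)
have inj x y : ball x0 d0 x -> ball x0 d0 y -> `|y - x| <= 2 * C * `|f y - f x|.
  move=> Bx By; have := est' x y Bx By.
  have := ler_normD (y - x - (f y - f x) *m B) ((f y - f x) *m B).
  rewrite subrK => H1 H2; have := HC (f y - f x).
  by move: H1 H2; move: `|_| `|_ - _| `|_ *m _| `|_ - _| => a b c g; lra.
pose d := d0 / 2; have dd0 : d < d0 by rewrite /d; lra.
have d_gt0 : 0 < d by rewrite divr_gt0.
pose rho := d / (2 * C); have rho0 : 0 < rho by rewrite divr_gt0 ?mulr_gt0.
have sdd0 : ball x0 d `<=` ball x0 d0.
  by move=> x /ball_normP H; apply/ball_normP; exact: lt_trans H dd0.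
have B0 : ball x0 d0 x0 by apply/ball_normP; rewrite subrr normr0.
have ex y : ball (f x0) rho y -> exists x, ball x0 d x /\ f x = y.
  (* Newton's iteration for f x = y, with the derivative frozen at x0. *)
  move=> /ball_normP yr; pose T x := x - (f x - y) *m B.
  have Bd0 x : `|x - x0| <= d -> ball x0 d0 x.
    by move=> H; apply/ball_normP; exact: le_lt_trans H dd0.
  have [||x xd Tx] := @contraction_fixpoint p x0 d T (ltW d_gt0).
  - move=> x xd.
    have -> : T x - x0 = (x - x0 - (f x - f x0) *m B) + (y - f x0) *m B.
      by rewrite /T !mulmxBl; apply/rowP => i; rewrite !mxE; ring.
    rewrite (le_trans (ler_normD _ _))//.
    have := est' x0 x B0 (Bd0 _ xd); have := HC (y - f x0).
    have : C * `|y - f x0| <= C * rho by rewrite ler_wpM2l// ltW.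
    have -> : C * rho = 2^-1 * d by rewrite /rho -eC /e; ring.
    have : 2^-1 * `|x - x0| <= 2^-1 * d by rewrite ler_wpM2l.
    lra.
  - move=> x z xd zd; have -> : T x - T z = (x - z) - (f x - f z) *m B.
      by rewrite /T !mulmxBl; apply/rowP => i; rewrite !mxE; ring.
    by apply: est'; exact: Bd0.
  have fxy : f x = y.
    have : (f x - y) *m B = 0 by apply/oppr_inj/(addrI x); rewrite oppr0 addr0.
    move=> /(congr1 (mulmx^~ A)); rewrite mul0mx -mulmxA mulVmx// mulmx1.
    exact: subr0_eq.
  exists x; split => //; apply/ball_normP.
  rewrite (le_lt_trans (inj _ _ B0 (Bd0 _ xd)))// fxy.
  by rewrite mulrC -ltr_pdivlMr ?mulr_gt0.
pose h y := xget x0 [set x | ball x0 d x /\ f x = y].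
have hP y : ball (f x0) rho y -> ball x0 d (h y) /\ f (h y) = y.
  by move=> /ex; exact: xgetPex.
have dh y : ball (f x0) rho y -> is_diff y h (fun v => v *m invmx ('J f (h y))).
  move=> yr; have [hd fh] := hP y yr.
  have [Uh uJ] := d0U _ (sdd0 _ hd).
  set J := 'J f (h y) in uJ *.
  have [C' C'0 HC'] := norm_mulmx_bound (invmx J).
  apply: (@is_diff_eps R _ _ h y (mulmxr (invmx J))).
    exact: mulmxr_continuous.
  move=> e1 e10; pose e2 := e1 / (C' * (2 * C)).
  have e20 : 0 < e2 by rewrite divr_gt0 ?mulr_gt0.
  have dfh : differentiable f (h y) by have [+ _] := sf 1%N; exact.
  have /nbhs_ballP[r /= r0 Hr] := diff_eps dfh e20.
  have nr : \forall z \near y, ball (f x0) rho z.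
    exact: open_nbhs_nbhs (conj (ball_open _ _) yr).
  have nr' : \forall z \near y, ball y (r / (2 * C)) z.
    by apply: nbhsx_ballx; rewrite divr_gt0 ?mulr_gt0.
  apply: filterS2 nr nr' => z zr /ball_normP zy.
  have [hdz fhz] := hP z zr.
  have hzy : `|h z - h y| <= 2 * C * `|z - y|.
    by have := inj _ _ (sdd0 _ hd) (sdd0 _ hdz); rewrite fh fhz.
  have /Hr : ball (h y) r (h z).
    apply/ball_normP; rewrite (le_lt_trans hzy)// mulrC.
    by rewrite -ltr_pdivlMr ?mulr_gt0.
  rewrite fh fhz -mul_jacobian -/J /= => H.
  have -> : h z - h y - (z - y) *m invmx J =
      - ((z - y - (h z - h y) *m J) *m invmx J).
    by rewrite [in RHS]mulmxBl -[_ *m J *m _]mulmxA mulmxV// mulmx1 opprB.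
  rewrite normrN (le_trans (HC' _))//.
  apply: (le_trans (ler_wpM2l (ltW C'0) H)); rewrite mulrA.
  apply: (le_trans (ler_wpM2l (ltW (mulr_gt0 C'0 e20)) hzy)).
  by rewrite /e2 !mulrA le_eqVlt; apply/orP; left; apply/eqP; field;
    rewrite !gt_eqF.
exists d, rho, h; split; [exact: d_gt0|exact: rho0| | |].
- by move=> x /sdd0 /d0U.
- (* The derivative of h is v *m invmx ('J f (h y)), as smooth as h itself. *)
  elim=> [|k IH].
    move=> y /dh hy; apply: differentiable_continuous; exact: ex_diff.
  split=> [y /dh hy|v]; first exact: ex_diff.
  apply: (@cont_diff_ext _ _ _ _ _ (fun y => v *m invmx ('J f (h y)))).
  + exact: ball_open.
  + move=> y; rewrite inE => yr; have hy := dh y yr.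
    by rewrite deriveE; [rewrite diff_val|exact: ex_diff].
  + apply: cont_diff_mulmx; [exact: ball_open|exact: cont_diff_cst|].
    apply: cont_diff_invmx; first exact: ball_open.
      by move=> y /hP[/sdd0 /d0U []].
    apply: (@cont_diff_comp _ _ _ _ _ _ _ U) => //; first exact: ball_open.
    by move=> y /hP[/sdd0 /d0U []].
- split=> [y yr|x xd fxr].
    by have [? ?] := hP y yr; split => //; exact: dh.
  have [hd fh] := hP _ fxr.
  apply/subr0_eq/eqP; rewrite -normr_le0.
  by rewrite (le_trans (inj _ _ (sdd0 _ xd) (sdd0 _ hd)))// fh subrr normr0 mulr0.
Qed.

End LocalInverse.

(** * The constant rank theorem *)

Section ConstantRank.
Context {R : realType}.

Lemma mxrank_unitl m n (A : 'M[R]_m) (B : 'M[R]_(m, n)) :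
  A \in unitmx -> \rank (A *m B) = \rank B.
Proof. by move=> uA; apply: eqmx_rank; rewrite !eqmxMfull ?row_full_unit// !submx_refl. Qed.

(** The kernel of J lies in that of J *m P, and both have the same dimension. *)
Lemma eq_rank_ker k m p (J : 'M[R]_(k, m)) (P : 'M[R]_(m, p)) :
  (\rank J <= \rank (J *m P)%R)%N ->
  forall u : 'rV_k, u *m J *m P = 0 -> u *m J = 0.
Proof.
move=> rk u uJP; apply/sub_kermxP.
have sK : (kermx J <= kermx (J *m P))%MS.
  by apply/sub_kermxP; rewrite mulmxA mulmx_ker mul0mx.
have := mxrank_leqif_eq sK => -[_].
rewrite !mxrank_ker.
have -> : \rank (J *m P) = \rank J.
  by apply/eqP; rewrite eqn_leq rk mxrankM_maxl.
rewrite eqxx => /esym/andP[_ KJ]; apply: submx_trans KJ.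
by apply/sub_kermxP; rewrite mulmxA.
Qed.

(** The constant rank theorem.  Write 'J f x0 = L *m pid_mx r *m Z with L and Z
    invertible.  Then G x = f x *m P + x *m Q, with P = invmx Z *m pid_mx r and
    Q = L *m copid_mx r, has invertible Jacobian L at x0.  In the coordinates
    given by its local inverse h, f does not depend on the coordinates killed by
    pid_mx r: if w is such a direction, the derivative of f o h along w is
    u *m 'J f for some u with u *m 'J f *m P = 0, and P kills nothing in the image
    of 'J f, because its rank does not exceed r.  Moreover Q reads the
    coordinates killed by pid_mx r, and the last clause identifies the kernel of
    'J f x0 with the directions tangent to the level set. *)
Lemma constant_rank k m r (U : set 'rV[R]_k) (f : 'rV[R]_k -> 'rV[R]_m) x0 :
  open U -> smooth_on U f -> U x0 -> (forall x, U x -> \rank ('J f x) = r) ->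
  exists (Q : 'M[R]_k) (y0 : 'rV[R]_k) (rho : R) (h : 'rV[R]_k -> 'rV[R]_k),
  [/\ 0 < rho /\ h y0 = x0,
      smooth_on (ball y0 rho) h /\ (forall y, ball y0 rho y -> U (h y)),
      (forall y w, ball y0 rho y -> ball y0 rho (y + w) ->
         w *m (pid_mx r : 'M[R]_k) = 0 ->
         f (h (y + w)) = f (h y) /\ (h (y + w) - h y) *m Q = w),
      (forall e : R, 0 < e -> \forall x \near x0,
         exists y, [/\ ball y0 rho y, ball y0 e y & h y = x]) &
      (forall v, v *m 'J f x0 = 0 ->
         'd h y0 (v *m Q) = v /\ v *m Q *m (pid_mx r : 'M[R]_k) = 0)].
Proof.
move=> oU sf Ux0 rk; pose J := 'J f x0.
have rJ : \rank J = r by exact: rk.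
have rk_k : (r <= k)%N by rewrite -rJ rank_leq_row.
have rk_m : (r <= m)%N by rewrite -rJ rank_leq_col.
pose L := col_ebase J; pose Z := row_ebase J.
have uL : L \in unitmx by exact: col_ebase_unit.
have uZ : Z \in unitmx by exact: row_ebase_unit.
have JE : J = L *m (pid_mx r : 'M[R]_(k, m)) *m Z by rewrite -rJ mulmx_ebase.
pose E : 'M[R]_k := pid_mx r.
pose P : 'M[R]_(m, k) := invmx Z *m pid_mx r.
pose Q : 'M[R]_k := L *m copid_mx r.
have PE : P *m E = P by rewrite /P -mulmxA pid_mx_id.
have QE : Q *m E = 0 by rewrite /Q -mulmxA mul_copid_mx_pid// mulmx0.
have PQ0 : P *m copid_mx r = 0 by rewrite /P -mulmxA mul_pid_mx_copid// mulmx0.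
have QQ : Q *m copid_mx r = Q by rewrite /Q -mulmxA copid_mx_id.
have JP : J *m P = L *m E.
  by rewrite JE /P mulmxA mulmxK// -mulmxA pid_mx_id.
pose G x := f x *m P + x *m Q.
have dG x : U x -> is_diff x G (fun v => v *m ('J f x *m P + Q)).
  move=> Ux; have df : differentiable f x by have [+ _] := sf 1%N; exact.
  have dP : is_diff (f x) (mulmxr P : 'rV[R]_m -> 'rV[R]_k) (mulmxr P).
    by apply: DiffDef; [apply: linear_differentiable|rewrite diff_lin//];
      exact: mulmxr_continuous.
  have dQ : is_diff x (mulmxr Q : 'rV[R]_k -> 'rV[R]_k) (mulmxr Q).
    by apply: DiffDef; [apply: linear_differentiable|rewrite diff_lin//];
      exact: mulmxr_continuous.
  have dfx := differentiableP df.
  have dfP : is_diff x ((mulmxr P : 'rV[R]_m -> 'rV[R]_k) \o f) _ :=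
    is_diff_comp dfx dP.
  apply: is_diff_eq (is_diffD dfP dQ) _.
  by apply/funext => v; rewrite !fctE /= -mul_jacobian mulmxDr mulmxA.
have JG x : U x -> 'J G x = 'J f x *m P + Q.
  move=> /dG Gx; apply/row_matrixP => i.
  by rewrite rowE mul_jacobian diff_val -rowE.
have sG : smooth_on U G.
  move=> j; apply: cont_diff_add => //; apply: cont_diff_mulmx => //;
  [exact: cont_diff_cst|exact: cont_diff_id|exact: cont_diff_cst].
have JG0 : 'J G x0 = L.
  by rewrite JG// -/J JP /Q -mulmxDr /copid_mx addrC subrK mulmx1.
have uG : 'J G x0 \in unitmx by rewrite JG0.
have [d [rho [h [d0 rho0 dU sh [hP hK]]]]] := local_inverse oU sG Ux0 uG.
have y0r : ball (G x0) rho (G x0) by exact: ballxx.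
exists Q, (G x0), rho, h; split.
- by split => //; apply: hK => //; exact: ballxx.
- by split => // y /hP[/dU []].
- move=> y w yr ywr wE0; split.
    apply: (@constant_along _ _ _ (fun y => f (h y))) => t t01.
    have ytw : ball (G x0) rho (y + t *: w) by exact: ball_segment.
    set z := y + t *: w in ytw *; have [hz Ghz dh] := hP z ytw.
    have [Uhz uz] := dU _ hz.
    have df : differentiable f (h z) by have [+ _] := sf 1%N; exact.
    have dhz : differentiable h z by exact: ex_diff.
    split; first exact: differentiable_comp.
    rewrite (@diff_comp _ _ _ _ h f)//= diff_val -mul_jacobian.
    set u := w *m _.
    have uw : u *m ('J f (h z) *m P + Q) = w by rewrite -JG// mulmxKV.
    have uP0 : u *m 'J f (h z) *m P = 0.
      have := congr1 (mulmx^~ E) uw; rewrite wE0 -mulmxA mulmxDl.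
      by rewrite -['J f (h z) *m P *m E]mulmxA PE QE addr0 mulmxA.
    apply: eq_rank_ker uP0; rewrite rk//.
    have JGE : 'J G (h z) *m E = 'J f (h z) *m P.
      by rewrite JG// mulmxDl -mulmxA PE QE addr0.
    rewrite -JGE -[X in (X <= _)%N](rank_pid_mx R rk_k rk_k) -/E.
    by rewrite -[X in (\rank X <= _)%N](mulKmx uz) mxrankM_maxr.
  have [_ Gy _] := hP y yr; have [_ Gyw _] := hP _ ywr.
  have GQ x : G x *m copid_mx r = x *m Q.
    by rewrite /G mulmxDl -[_ *m P *m _]mulmxA PQ0 mulmx0 add0r -mulmxA QQ.
  rewrite mulmxBl -!GQ Gy Gyw mulmxDl addrC addKr.
  by rewrite /copid_mx mulmxBr mulmx1 wE0 subr0.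
- move=> e e0; have Gc : {for x0, continuous G} by exact: sG 0%N x0 Ux0.
  have n1 : \forall x \near x0, ball (G x0) rho (G x).
    by apply: Gc; exact: nbhsx_ballx.
  have n2 : \forall x \near x0, ball x0 d x by exact: nbhsx_ballx.
  have n3 : \forall x \near x0, ball (G x0) e (G x).
    by apply: Gc; exact: nbhsx_ballx.
  by apply: filterS3 n1 n2 n3 => x xr xd xe; exists (G x); split => //; exact: hK.
- move=> v vJ0; have [_ _ dh] := hP _ y0r.
  rewrite diff_val hK//; last exact: ballxx.
  have vLE : v *m L *m E = 0 by rewrite -mulmxA -JP mulmxA vJ0 mul0mx.
  split; last by rewrite -mulmxA QE mulmx0.
  by rewrite JG0 /Q mulmxA /copid_mx mulmxBr mulmx1 vLE subr0 mulmxK.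
Qed.

End ConstantRank.

(** * Level sets and images of maps of constant rank *)

Section LevelSets.
Context {R : realType}.

Lemma smooth_comp (V : normedModType R) p q r (U : set V) (U' : set 'rV[R]_p)
    (f : V -> 'rV[R]_p) (g : 'rV[R]_p -> 'M[R]_(q, r)) :
  open U -> open U' -> (forall x, U x -> U' (f x)) ->
  smooth_on U f -> smooth_on U' g -> smooth_on U (fun x : V => g (f x)).
Proof.
by move=> oU oU' UU' sf sg k; exact: cont_diff_comp (sf k) (sg k).
Qed.

Lemma diff_coord p q (x v : 'M[R]_(p, q)) i j :
  'd (fun M : 'M[R]_(p, q) => M i j : R) x v = v i j.
Proof.
rewrite -deriveE; last exact: differentiable_coord.
have := derive_mx (@derivable_id R 'M[R]_(p, q) x v).
by rewrite derive_id => {2}->; rewrite mxE.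
Qed.

(** s / (1 + a^2 s^2) is a smooth function on the whole line, bounded by
    1 / (2 a) and tangent to s at 0; it turns a curve defined near 0 into one
    defined everywhere, with the same velocity. *)
Definition squeeze (a : R) (t : 'rV[R]_1) : R := t 0 0 * (1 + a ^+ 2 * t 0 0 ^+ 2)^-1.

Lemma squeeze_bound a t : 0 < a -> `|squeeze a t| * a <= 2^-1.
Proof.
move=> a0; rewrite /squeeze; move: (t 0 0) => s.
have D0 : 0 < 1 + a ^+ 2 * s ^+ 2.
  by rewrite ltr_wpDr// mulr_ge0// sqr_ge0.
rewrite normrM [ `|_^-1|]gtr0_norm ?invr_gt0// mulrAC ler_pdivrMr//.
have := sqr_ge0 (1 - a * `|s|).
have <- : `|s| ^+ 2 = s ^+ 2 by rewrite -normrX ger0_norm// sqr_ge0.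
nra.
Qed.

Lemma squeeze_den a (t : 'rV[R]_1) : 1 + a ^+ 2 * t 0 0 ^+ 2 != 0.
Proof. by rewrite gt_eqF// ltr_wpDr// mulr_ge0// sqr_ge0. Qed.

Lemma smooth_squeeze_inv a k :
  cont_diff k setT (fun t : 'rV[R]_1 => (1 + a ^+ 2 * t 0 0 ^+ 2)^-1).
Proof.
have c0 : cont_diff k setT (fun t : 'rV[R]_1 => t 0 0).
  by apply: (cont_diff_mx _ (id : 'rV[R]_1 -> _) openT).1; exact: cont_diff_id.
apply: cont_diff_inv; [exact: openT|by move=> t _; exact: squeeze_den|].
apply: cont_diff_add; [exact: openT|exact: cont_diff_cst|].
apply: cont_diff_mul; [exact: openT|exact: cont_diff_cst|].
by under eq_fun do rewrite expr2; apply: cont_diff_mul => //; exact: openT.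
Qed.

Lemma smooth_squeeze a k : cont_diff k setT (squeeze a).
Proof.
apply: cont_diff_mul; [exact: openT| |exact: smooth_squeeze_inv].
by apply: (cont_diff_mx _ (id : 'rV[R]_1 -> _) openT).1; exact: cont_diff_id.
Qed.

Lemma diff_squeeze a v : 'd (squeeze a) 0 v = v 0 0.
Proof.
pose s (t : 'rV[R]_1) : R := t 0 0.
pose g (t : 'rV[R]_1) : R := (1 + a ^+ 2 * t 0 0 ^+ 2)^-1.
have ds : differentiable s 0 by exact: differentiable_coord.
have dg : differentiable g 0.
  by have [+ _] := smooth_squeeze_inv a 1; exact.
have -> : squeeze a = s * g by [].
rewrite diffM// /s /g mxE.
rewrite [LHS](_ : _ = 0 *: 'd g 0 v + g 0 *: 'd s 0 v); last by rewrite /g mxE.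
rewrite scale0r add0r /g mxE.
by rewrite expr0n mulr0 addr0 invr1 scale1r diff_coord.
Qed.

(** In the coordinates of the constant rank theorem the level set through x0 is
    flat, and the curve is a straight line run at the speed of [squeeze]. *)
Lemma level_curve k m r (U : set 'rV[R]_k) (f : 'rV[R]_k -> 'rV[R]_m) x0 v :
  open U -> smooth_on U f -> U x0 -> (forall x, U x -> \rank ('J f x) = r) ->
  v *m 'J f x0 = 0 ->
  exists c : 'rV[R]_1 -> 'rV[R]_k,
    [/\ smooth_on setT c, c 0 = x0, forall t, U (c t),
        forall t, f (c t) = f x0 & 'd c 0 (const_mx 1) = v].
Proof.
move=> oU sf Ux0 rk vJ0.
have [Q [y0 [rho [h [[rho0 hy0] [sh hU] hfib _ hv]]]]] := constant_rank oU sf Ux0 rk.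
have [hvQ vQ0] := hv v vJ0; set w := v *m Q in hvQ vQ0.
(* Large enough for the curve to stay in the ball of radius rho. *)
pose a := `|w| / rho + 1; have a0 : 0 < a by rewrite ltr_wpDl ?divr_ge0// ltW.
pose b (t : 'rV[R]_1) := y0 + squeeze a t *: w.
have wa : `|w| < a * rho by rewrite mulrDl divfK ?gt_eqF// mul1r ltrDl.
have bB t : ball y0 rho (b t).
  apply/ball_normP; rewrite /b addrAC subrr add0r normrZ.
  rewrite -(ltr_pM2l a0) mulrA [a * `|_|]mulrC.
  have := ler_wpM2r (normr_ge0 w) (squeeze_bound t a0).
  have : 0 <= `|w| by []. lra.
have b0 : b 0 = y0 by rewrite /b /squeeze mxE mul0r scale0r addr0.
have y0B : ball y0 rho y0 by exact: ballxx.
have sb : smooth_on setT b.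
  move=> j; apply: cont_diff_add; [exact: openT|exact: cont_diff_cst|].
  apply/cont_diff_mx; first exact: openT.
  move=> i l; under eq_fun do rewrite mxE.
  by apply: cont_diff_mul; [exact: openT|exact: smooth_squeeze|exact: cont_diff_cst].
exists (fun t => h (b t)); split.
- exact: (smooth_comp openT (ball_open _ _) (fun t _ => bB t) sb sh).
- by rewrite b0.
- by move=> t; exact/hU/bB.
- move=> t; rewrite -hy0; apply: (hfib _ _ y0B (bB t) _).1.
  by rewrite -scalemxAl vQ0 scaler0.
- have db : differentiable b 0 by exact: (sb 1%N).1.
  have dh : differentiable h (b 0).
    by rewrite b0; have [+ _] := sh 1%N; exact.
  rewrite (@diff_comp _ _ _ _ b h)// b0 /= -hvQ; congr ('d h y0 _).
  have ds : differentiable (squeeze a) 0.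
    by have [+ _] := smooth_squeeze a 1; exact.
  have dw : is_diff 0 (fun t => squeeze a t *: w) (fun v => v 0 0 *: w).
    apply: DiffDef; first exact: differentiableZl.
    by rewrite diffZl//; apply/funext => u; rewrite diff_squeeze.
  have db0 : is_diff 0 b (fun u => 0 + u 0 0 *: w).
    exact: is_diff_eq (is_diffD (is_diff_cst y0 0) dw) _.
  by rewrite diff_val mxE scale1r add0r.
Qed.

(** Near x0, f only depends on r coordinates, so the image of a neighborhood of
    x0 is contained in a Lipschitz image of a ball of R^r. *)
Lemma local_image k m r (U : set 'rV[R]_k) (f : 'rV[R]_k -> 'rV[R]_m) x0 :
  open U -> smooth_on U f -> U x0 -> (forall x, U x -> \rank ('J f x) = r) ->
  exists (g : 'rV[R]_r -> 'rV[R]_m) (d K : R),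
    [/\ 0 < d, 0 < K,
        forall s t, `|s| <= d -> `|t| <= d -> `|g s - g t| <= K * `|s - t| &
        \forall x \near x0, exists2 t, `|t| <= d & f x = g t].
Proof.
move=> oU sf Ux0 rk.
have [Q [y0 [rho [h [[rho0 hy0] [sh hU] hfib hnear _]]]]] :=
  constant_rank oU sf Ux0 rk.
pose I1 : 'M[R]_(r, k) := pid_mx r; pose I2 : 'M[R]_(k, r) := pid_mx r.
have [C1 C10 HC1] := norm_mulmx_bound I1.
have [C2 C20 HC2] := norm_mulmx_bound I2.
pose b (t : 'rV[R]_r) := y0 + t *m I1.
pose d1 := rho / C1; have d10 : 0 < d1 by rewrite divr_gt0.
have bB t : `|t| < d1 -> ball y0 rho (b t).
  move=> td; apply/ball_normP; rewrite /b addrAC subrr add0r.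
  by rewrite (le_lt_trans (HC1 _))// mulrC -ltr_pdivlMr.
pose g t := f (h (b t)).
have sg : smooth_on (ball 0 d1) g.
  apply: (@smooth_comp _ _ _ _ _ U) => //; first exact: ball_open.
    by move=> t /ball_normP; rewrite subr0 => /bB /hU.
  apply: (@smooth_comp _ _ _ _ _ (ball y0 rho)) => //; try exact: ball_open.
    by move=> t /ball_normP; rewrite subr0 => /bB.
  move=> j; apply: cont_diff_add; [exact: ball_open|exact: cont_diff_cst|].
  by apply: cont_diff_mulmx; [exact: ball_open|exact: cont_diff_id|exact: cont_diff_cst].
have [d2 d20 [d2sub est]] :=
  strict_diff (ball_open _ _) (sg 1%N) (ballxx 0 d10) ltr01.
have [C3 C30 HC3] := norm_mulmx_bound ('J g 0).
pose d := d2 / 2; have d0 : 0 < d by rewrite divr_gt0.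
have dd2 (t : 'rV[R]_r) : `|t| <= d -> ball 0 d2 t.
  move=> td; apply/ball_normP; rewrite subr0 (le_lt_trans td)// /d; lra.
exists g, d, (1 + C3); split => //.
- by rewrite addr_gt0.
- move=> s t /dd2 sd /dd2 td; have := est t s td sd; rewrite mul1r => H.
  rewrite -[g s - g t](subrK ((s - t) *m 'J g 0)).
  rewrite (le_trans (ler_normD _ _))// mulrDl mul1r.
  by rewrite lerD// HC3.
pose e := d / C2; have e0 : 0 < e by rewrite divr_gt0.
apply: filterS (hnear e e0) => x [y [yr ye hyx]].
pose t := (y - y0) *m I2.
have td : `|t| <= d.
  rewrite (le_trans (HC2 _))// mulrC -ler_pdivlMr//.
  by move/ball_normP: ye => /ltW.
exists t => //.
have /d2sub/ball_normP := dd2 _ td; rewrite subr0 => /bB bt.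
have rk_k : (r <= k)%N by rewrite -(rk _ Ux0) rank_leq_row.
have yE : y = b t + (y - b t) by rewrite subrKC.
rewrite -hyx /g yE; apply: (hfib _ _ bt _ _).1; first by rewrite -yE.
rewrite /b /t -mulmxA pid_mx_id// opprD addrA mulmxBl.
by rewrite -[_ *m _ *m pid_mx r]mulmxA pid_mx_id// subrr.
Qed.

(** S embeds, and T reads, the k - r coordinates that pid_mx r kills. *)
Lemma copid_coordinates k r : (r <= k)%N ->
  exists (S : 'M[R]_(k - r, k)) (T : 'M[R]_(k, k - r)),
    S *m (pid_mx r : 'M[R]_k) = 0 /\ S *m T = 1%:M.
Proof.
move=> rk; rewrite -(rank_copid_mx R rk); set C := copid_mx r.
exists (row_base C), (pinvmx (row_base C)); split.
  have : (row_base C <= C)%MS by rewrite eq_row_base.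
  by case/submxP => D ->; rewrite -mulmxA mul_copid_mx_pid// mulmx0.
by apply: mulmxVp; exact: row_base_free.
Qed.

(** The level set through x0 has dimension k - r, in the sense that an affine map
    sends a part of it onto a ball of that dimension. *)
Lemma level_slice k m r (U : set 'rV[R]_k) (f : 'rV[R]_k -> 'rV[R]_m) x0 :
  open U -> smooth_on U f -> U x0 -> (forall x, U x -> \rank ('J f x) = r) ->
  exists (P : 'M[R]_(k, k - r)) (rho : R), 0 < rho /\
    forall t, `|t| < rho -> exists x, [/\ U x, f x = f x0 & (x - x0) *m P = t].
Proof.
move=> oU sf Ux0 rk.
have [Q [y0 [rho [h [[rho0 hy0] [sh hU] hfib _ _]]]]] := constant_rank oU sf Ux0 rk.
have rk_k : (r <= k)%N by rewrite -(rk _ Ux0) rank_leq_row.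
have [S [T [SE ST]]] := copid_coordinates rk_k.
have [C C0 HC] := norm_mulmx_bound S.
exists (Q *m T), (rho / C); split; first by rewrite divr_gt0.
move=> t td; pose w := t *m S.
have wE : w *m (pid_mx r : 'M[R]_k) = 0 by rewrite -mulmxA SE mulmx0.
have y0B : ball y0 rho y0 by exact: ballxx.
have wB : ball y0 rho (y0 + w).
  apply/ball_normP; rewrite addrAC subrr add0r (le_lt_trans (HC _))//.
  by rewrite mulrC -ltr_pdivlMr.
have [fw Qw] := hfib _ _ y0B wB wE.
exists (h (y0 + w)); split; [exact: hU|by rewrite fw hy0|].
by rewrite -hy0 mulmxA Qw -mulmxA ST mulmx1.
Qed.

End LevelSets.

(** * Lipschitz images in higher dimension *)

Section LipschitzImages.
Context {R : realType}.

Lemma truncn_eq_dist (x y : R) : 0 <= x -> 0 <= y ->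
  Num.truncn x = Num.truncn y -> `|x - y| <= 1.
Proof.
move=> /truncn_itv/andP[x1 x2] /truncn_itv/andP[y1 y2] xy.
move: x1 x2 y1 y2; rewrite xy -natr1 => x1 x2 y1 y2.
by rewrite ler_norml; apply/andP; split; lra.
Qed.

(** Cut the cube of radius a of R^r into about N^r cells: two points of the same
    cell have images at distance at most 2 K a / N.  A ball of radius e in R^d
    contains q^d points at mutual distance at least e / (2 q); if g came
    arbitrarily close to all of them, distinct points would need distinct cells.
    With N proportional to q this gives q^d <= C q^r for a constant C and all q,
    which is false as r < d. *)
Lemma lipschitz_image_nowhere_dense r d (g : 'rV[R]_r -> 'rV[R]_d) (a K e : R)
    (b : 'rV[R]_d) : (r < d)%N -> 0 < a -> 0 < K -> 0 < e ->
  (forall s t, `|s| <= a -> `|t| <= a -> `|g s - g t| <= K * `|s - t|) ->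
  ~ (forall y, `|y - b| < e -> forall h, 0 < h ->
       exists2 t, `|t| <= a & `|y - g t| < h).
Proof.
move=> rd a0 K0 e0 gK gD.
pose A := (Num.truncn (8 * K * a / e)).+1.
have A_gt : 8 * K * a < A%:R * e by rewrite -ltr_pdivrMr// truncnS_gt.
(* N = A q makes the images of cells small compared with e / q, and q exceeds
   the constant A.+1 ^ r of the final comparison. *)
pose q := (A.+1 ^ r).+1; pose N := (A * q)%N.
have q0 : 0 < q%:R :> R by rewrite ltr0n.
have N0 : 0 < N%:R :> R by rewrite ltr0n.
pose pt (c : {ffun 'I_d -> 'I_q}) : 'rV[R]_d :=
  b + \row_j ((c j)%:R * (e / (2 * q%:R))).
have step0 : 0 < e / (2 * q%:R) by rewrite divr_gt0 ?mulr_gt0.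
have pt_near c : `|pt c - b| < e.
  rewrite /pt addrAC subrr add0r; apply: (@le_lt_trans _ _ (e / 2)); last lra.
  apply: norm_mx_le => [|i j]; first by rewrite divr_ge0// ltW.
  rewrite mxE ger0_norm; last by rewrite mulr_ge0// ltW.
  apply: (@le_trans _ _ (q%:R * (e / (2 * q%:R)))).
    by rewrite ler_wpM2r ?(ltW step0)// ler_nat ltnW.
  by rewrite invfM mulrCA [q%:R * _]mulrCA mulfV ?gt_eqF// mulr1.
pose h := e / (8 * q%:R); have h0 : 0 < h by rewrite divr_gt0 ?mulr_gt0.
pose near_pt c := [set t : 'rV[R]_r | `|t| <= a /\ `|pt c - g t| < h].
pose tt c := xget 0 (near_pt c).
have ttP c : `|tt c| <= a /\ `|pt c - g (tt c)| < h.
  suff ex : exists t, near_pt c t by exact: (xgetPex 0 ex).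
  by have [t ta th] := gD _ (pt_near c) _ h0; exists t.
pose scale (s : R) := (s + a) / (2 * a) * N%:R.
pose cell (t : 'rV[R]_r) : {ffun 'I_r -> 'I_N.+1} :=
  [ffun j => inord (Num.truncn (scale (t 0 j)))].
have scale_ge0 s : `|s| <= a -> 0 <= scale s.
  move=> sa; rewrite !mulr_ge0 ?invr_ge0 ?mulr_ge0// ?(ltW a0)//.
  by move: sa; rewrite ler_norml => /andP[]; lra.
have scale_le s : `|s| <= a -> (Num.truncn (scale s) < N.+1)%N.
  move=> sa; rewrite truncn_lt_nat ?scale_ge0//.
  apply: (@le_lt_trans _ _ N%:R); last by rewrite ltr_nat.
  rewrite ler_piMl ?ler0n// ler_pdivrMr ?mulr_gt0// mul1r.
  by move: sa; rewrite ler_norml => /andP[]; lra.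
have cell_near s t : `|s| <= a -> `|t| <= a -> cell s = cell t ->
    `|s - t| <= 2 * a / N%:R.
  move=> sa ta /ffunP st; apply: norm_mx_le => [|i j].
    by rewrite divr_ge0// mulr_ge0// ltW.
  have sj : `|s 0 j| <= a by apply: le_trans sa; exact: norm_coord.
  have tj : `|t 0 j| <= a by apply: le_trans ta; exact: norm_coord.
  have := st j; rewrite !ffunE => /(congr1 val) /=.
  rewrite !inordK ?scale_le// => /(truncn_eq_dist (scale_ge0 _ sj) (scale_ge0 _ tj)).
  rewrite -mulrBl -mulrBl opprD addrACA subrr addr0 !normrM.
  rewrite [ `|N%:R|]ger0_norm// [ `|_^-1|]ger0_norm ?invr_ge0 ?mulr_ge0 ?(ltW a0)//.
  rewrite ord1 !mxE -ler_pdivlMr// mul1r ler_pdivrMr ?mulr_gt0//.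
  by rewrite mulrC.
have inj : injective (fun c => cell (tt c)).
  move=> c c' cc'; apply/ffunP => j; apply/eqP; apply: contraT => cj.
  have [tc1 tc2] := ttP c; have [tc1' tc2'] := ttP c'.
  have H1 := gK _ _ tc1 tc1'; have H2 := cell_near _ _ tc1 tc1' cc'.
  have H3 : K * `|tt c - tt c'| <= K * (2 * a / N%:R) by rewrite ler_wpM2l// ltW.
  have H4 : K * (2 * a / N%:R) < 2 * h.
    rewrite mulrA ltr_pdivrMr// /N natrM /h.
    move: (q%:R : R) (A%:R : R) q0 A_gt => Q B Q0 B_gt.
    have -> : 2 * (e / (8 * Q)) * (B * Q) = (B * e) / 4 by field; rewrite gt_eqF.
    clear -B_gt. lra.
  have H5 : `|pt c - pt c'| < 4 * h.
    have -> : pt c - pt c' =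
        (pt c - g (tt c)) + (g (tt c) - g (tt c')) - (pt c' - g (tt c')).
      by move: (pt c) (pt c') (g _) (g _) => p1 p2 g1 g2;
        apply/rowP => i; rewrite !mxE; ring.
    have -> : 4 * h = h + 2 * h + h by clear; ring.
    rewrite (le_lt_trans (ler_normB _ _))// ltrD//.
    rewrite (le_lt_trans (ler_normD _ _))// ltrD//.
    exact: le_lt_trans H1 (le_lt_trans H3 H4).
  have H6 : e / (2 * q%:R) <= `|pt c - pt c'|.
    apply: (le_trans _ (norm_coord _ 0 j)).
    rewrite /pt opprD addrACA subrr add0r !mxE -mulrBl normrM.
    rewrite [ `|e / _|](ger0_norm (ltW step0)) (ler_peMl (ltW step0))//.
    have : `|(c j)%:Z - (c' j)%:Z| >= 1.
      by rewrite -gtz0_ge1 normr_gt0 subr_eq0; apply: contra cj => /eqP[] /val_inj ->.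
    rewrite -(@ler_int R) => /le_trans; apply.
    by rewrite intr_norm rmorphB.
  have H7 : e / (2 * q%:R) = 4 * h by rewrite /h; move: (q%:R : R) q0 => Q Q0; field; rewrite gt_eqF.
  by move: H5; rewrite -H7 ltNge H6.
have := leq_card _ inj; rewrite !card_ffun !card_ord => H.
have Nq : (N.+1 <= A.+1 * q)%N by rewrite mulSn addnC -addn1 leq_add2l.
have Nqr : (N.+1 ^ r <= (A.+1 * q) ^ r)%N.
  by move: (r) => i; elim: i => // i IH; rewrite !expnS leq_mul.
have : (q ^ r.+1 <= A.+1 ^ r * q ^ r)%N.
  by rewrite -expnMn (leq_trans _ Nqr)// (leq_trans _ H)// leq_pexp2l.
rewrite expnS leq_pmul2r ?expn_gt0//.
by rewrite /q ltnn.
Qed.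

(** The complements of the closures of the F i are open and dense. *)
Lemma Baire_rV d (F : nat -> set 'rV[R]_d) (b : 'rV[R]_d) (e : R) : 0 < e ->
  (forall i (c : 'rV[R]_d) (f : R), 0 < f -> ~ ball c f `<=` closure (F i)) ->
  ~ ball b e `<=` \bigcup_i F i.
Proof.
move=> e0 nd cov.
pose X : completeNormedModType R := HB.pack_for (completeNormedModType R) 'rV[R]_d.
pose G i : set X := ~` closure (F i).
have GP i : open (G i) /\ dense (G i).
  split; first by apply: closed_openC; exact: closed_closure.
  move=> O [x Ox] oO.
  have /nbhs_ballP[f /= f0 fO] : nbhs x O by exact: open_nbhs_nbhs.
  have := nd i x f f0 => /existsNP[y] /not_implyP[xy nFy].
  by exists y; split=> //; exact: fO.
have [y [yb yG]] := Baire GP (ex_intro _ b (ballxx b e0)) (@ball_open _ X b e).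
have [i _ Fiy] := cov y yb.
by apply: (yG i I); exact: subset_closure.
Qed.

End LipschitzImages.

(** * Coordinate expressions and Jacobians *)

Section Jacobians.
Context {R : realType}.

Lemma open_preimage_on (V W : normedModType R) (U : set V) (O : set W) (f : V -> W) :
  open U -> open O -> cont_diff 0 U f -> open (U `&` f @^-1` O).
Proof.
move=> oU oO fc; rewrite openE => x [Ux Ofx].
apply: filterI; first exact: open_nbhs_nbhs.
by apply: (fc x Ux); exact: open_nbhs_nbhs.
Qed.

Definition covering n T (A : atlas R n T) := forall p, exists i : idx A, dom i p.

(** Injectivity of charts, stated for atlases alone: it is also needed for
    products and for tangent bundles. *)
Definition separating n T (A : atlas R n T) := forall (i : idx A) p q,
  dom i p -> dom i q -> crd i p = crd i q -> p = q.

Section TwoAtlases.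
Context {m n : nat} {S T : Type} {A : atlas R m S} {B : atlas R n T}.
Hypothesis sA : separating A.

Definition jac (f : S -> T) (i : idx A) (j : idx B) (p : S) : 'M[R]_(m, n) :=
  'J (local_rep f i j) (crd i p).

Lemma local_repE (f : S -> T) (i : idx A) (j : idx B) p :
  dom i p -> dom j (f p) -> local_rep f i j (crd i p) = crd j (f p).
Proof.
move=> ip jfp; rewrite /local_rep; set X := (X in xget 0 X).
have : X (xget 0 X) by apply: xgetPex; exists (crd j (f p)); exists p.
by move=> [q [iq jfq /(sA iq ip) -> ]].
Qed.

Lemma local_domP (f : S -> T) (i : idx A) (j : idx B) p :
  dom i p -> local_dom f i j (crd i p) <-> dom j (f p).
Proof.
move=> ip; split=> [[q [iq jfq] /(sA iq ip) <-//]|jfp].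
by exists p.
Qed.

Lemma smooth_local_rep_diff (f : S -> T) (i : idx A) (j : idx B) p :
  smooth A B f -> dom i p -> dom j (f p) ->
  differentiable (local_rep f i j) (crd i p).
Proof.
move=> sf ip jfp; have [_ sd] := sf i j.
have [H _] := sd 1%N; apply: H; exact/local_domP.
Qed.

End TwoAtlases.

Section Composition.
Context {m n q : nat} {S T Y : Type} {A : atlas R m S} {B : atlas R n T}
  {C : atlas R q Y}.
Hypothesis sA : separating A.
Hypothesis sB : separating B.
Hypothesis cB : covering B.
Variables (f : S -> T) (g : T -> Y).
Hypotheses (sf : smooth A B f) (sg : smooth B C g).

Let piece (i : idx A) (j : idx B) (k : idx C) : set 'rV[R]_m :=
  local_dom f i j `&` local_rep f i j @^-1` local_dom g j k.

Let piece_open i j k : open (piece i j k).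
Proof.
have [of_ cf] := sf i j; have [og _] := sg j k.
by apply: open_preimage_on => //; exact: (cf 0%N).
Qed.

Let pieceP i j k p : dom i p -> piece i j k (crd i p) <->
  dom j (f p) /\ dom k (g (f p)).
Proof.
move=> ip; split=> [[/(local_domP sA _ _ ip) jfp]|[jfp kgfp]].
  by rewrite /= (local_repE sA)// => /(local_domP sB _ _ jfp).
split; first exact/(local_domP sA).
by rewrite /= (local_repE sA)//; exact/(local_domP sB).
Qed.

Let piece_rep i j k x : piece i j k x ->
  local_rep (A := A) (B := C) (fun p => g (f p)) i k x =
  local_rep g j k (local_rep f i j x).
Proof.
move=> Px; have [p [ip _] px] := Px.1; rewrite -px in Px *.
have [jfp kgfp] := (pieceP _ _ ip).1 Px.
by rewrite !(local_repE sA)// (local_repE sB).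
Qed.

(** The domain of the coordinate expression of the composite is the union, over
    the charts j of the middle space, of the open pieces on which the two
    coordinate expressions through j can be composed. *)
Lemma smooth_compose : smooth A C (fun p => g (f p)).
Proof.
move=> i k.
have domE : local_dom (fun p => g (f p)) i k = \bigcup_j piece i j k.
  apply/seteqP; split=> [x [p [ip kgfp] <-]|x [j _ Px]].
    by have [j jfp] := cB (f p); exists j => //; exact/pieceP.
  have [p [ip _] px] := Px.1; rewrite -px in Px *.
  by apply/(local_domP sA) => //; have [] := (pieceP _ _ ip).1 Px.
split; first by rewrite domE; apply: bigcup_open => j _; exact: piece_open.
move=> r; apply: cont_diff_local => x; rewrite domE => -[j _ Px].
exists (piece i j k) => //.
apply: (@cont_diff_ext _ _ _ _ _ (fun x => local_rep g j k (local_rep f i j x))).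
- exact: piece_open.
- by move=> y; rewrite inE => /piece_rep ->.
- have [_ cf] := sf i j; have [og cg] := sg j k.
  apply: cont_diff_comp (cg r) => //; first by move=> y [].
  by apply: cont_diff_sub (cf r) => y [].
Qed.

Lemma jac_compose (i : idx A) (j : idx B) (k : idx C) p : dom i p -> dom j (f p) -> dom k (g (f p)) ->
  jac (A := A) (B := C) (fun p => g (f p)) i k p =
  jac f i j p *m jac g j k (f p).
Proof.
move=> ip jfp kgfp.
have Pp : piece i j k (crd i p) by exact/pieceP.
have df := smooth_local_rep_diff sA sf ip jfp.
have dg : differentiable (local_rep g j k) (local_rep f i j (crd i p)).
  by rewrite (local_repE sA)//; exact: smooth_local_rep_diff.
have H : is_diff (crd i p) (local_rep (A := A) (B := C) (fun p => g (f p)) i k)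
    ('d (local_rep g j k \o local_rep f i j) (crd i p)).
  have nP : \forall x \near crd i p, piece i j k x.
    by apply: open_nbhs_nbhs; split; [exact: piece_open|exact: Pp].
  apply: near_eq_is_diff; last exact: differentiable_comp.
  by apply: filterS nP => x /piece_rep ->.
apply: (jacobianP H) => v.
rewrite (diff_comp df dg) mulmxA !mul_jacobian.
by rewrite /comp (local_repE sA).
Qed.

End Composition.

Section Pairing.
Context {m n q : nat} {S T Y : Type} {A : atlas R m S} {B : atlas R n T}
  {C : atlas R q Y}.

Lemma covering_prod : covering B -> covering C -> covering (prod_atlas B C).
Proof.
by move=> cB cC [p1 p2]; have [i ?] := cB p1; have [j ?] := cC p2; exists (i, j).
Qed.

Lemma separating_prod : separating B -> separating C -> separating (prod_atlas B C).
Proof.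
move=> sB sC [i j] [p1 p2] [q1 q2] [/= ip jp] [/= iq jq] /eq_row_mx[e1 e2].
by rewrite (sB _ _ _ ip iq e1) (sC _ _ _ jp jq e2).
Qed.

Hypothesis sA : separating A.
Variables (f : S -> T) (g : S -> Y).
Hypotheses (sf : smooth A B f) (sg : smooth A C g).

Lemma row_mx_sum (u : 'rV[R]_n) (v : 'rV[R]_q) :
  row_mx u v = u *m row_mx 1%:M 0 + v *m row_mx 0 1%:M.
Proof. by rewrite !mul_mx_row !mulmx1 !mulmx0 add_row_mx addr0 add0r. Qed.

Let dom_pair (i : idx A) (jk : idx B * idx C) :
  local_dom (A := A) (B := prod_atlas B C) (fun p => (f p, g p)) i jk =
  local_dom f i jk.1 `&` local_dom g i jk.2.
Proof.
apply/seteqP; split=> [x [p [ip [/= jfp kgp]] <-]|x [[p [ip jfp] <-]]].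
  by split; exact/(local_domP sA).
by move/(local_domP sA _ _ ip) => kgp; exists p.
Qed.

Let rep_pair (i : idx A) (jk : idx B * idx C) x :
  (local_dom f i jk.1 `&` local_dom g i jk.2) x ->
  local_rep (A := A) (B := prod_atlas B C) (fun p => (f p, g p)) i jk x =
  row_mx (local_rep f i jk.1 x) (local_rep g i jk.2 x).
Proof.
move=> [[p [ip jfp] <-]] /(local_domP sA _ _ ip) kgp.
by rewrite !(local_repE sA).
Qed.

Lemma smooth_pair : smooth A (prod_atlas B C) (fun p => (f p, g p)).
Proof.
move=> i [j k]; have [of_ cf] := sf i j; have [og cg] := sg i k.
rewrite dom_pair; split=> [|r]; first exact: openI.
apply: (@cont_diff_ext _ _ _ _ _
  (fun x => local_rep f i j x *m row_mx 1%:M 0 + local_rep g i k x *m row_mx 0 1%:M)).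
- exact: openI.
- by move=> x; rewrite inE => /rep_pair ->; rewrite row_mx_sum.
- have o := openI of_ og; apply: cont_diff_add => //; apply: cont_diff_mulmx => //;
    try exact: cont_diff_cst.
    by apply: cont_diff_sub (cf r) => x [].
  by apply: cont_diff_sub (cg r) => x [].
Qed.

Lemma jac_pair (i : idx A) (j : idx B) (k : idx C) p :
  dom i p -> dom j (f p) -> dom k (g p) ->
  jac (A := A) (B := prod_atlas B C) (fun p => (f p, g p)) i (j, k) p =
  row_mx (jac f i j p) (jac g i k p).
Proof.
move=> ip jfp kgp.
have [of_ _] := sf i j; have [og _] := sg i k.
have Dp : (local_dom f i j `&` local_dom g i k) (crd i p).
  by split; exact/(local_domP sA).
have df := smooth_local_rep_diff sA sf ip jfp.
have dg := smooth_local_rep_diff sA sg ip kgp.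
pose M1 : 'M[R]_(n, n + q) := row_mx 1%:M 0.
pose M2 : 'M[R]_(q, n + q) := row_mx 0 1%:M.
have dM r s (M : 'M[R]_(r, s)) y : is_diff y (mulmxr M : 'rV[R]_r -> 'rV[R]_s) (mulmxr M).
  by apply: DiffDef; [apply: linear_differentiable|rewrite diff_lin//];
    exact: mulmxr_continuous.
have d1 : is_diff (crd i p) ((mulmxr M1 : 'rV[R]_n -> 'rV[R]_(n + q)) \o local_rep f i j) _ :=
  is_diff_comp (differentiableP df) (dM _ _ M1 _).
have d2 : is_diff (crd i p) ((mulmxr M2 : 'rV[R]_q -> 'rV[R]_(n + q)) \o local_rep g i k) _ :=
  is_diff_comp (differentiableP dg) (dM _ _ M2 _).
have d12 := is_diffD d1 d2.
have nD : \forall x \near crd i p, (local_dom f i j `&` local_dom g i k) x.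
  by apply: open_nbhs_nbhs; split; [exact: openI|exact: Dp].
have H : is_diff (crd i p)
    (local_rep (A := A) (B := prod_atlas B C) (fun p => (f p, g p)) i (j, k))
    ('d ((mulmxr M1 \o local_rep f i j) + (mulmxr M2 \o local_rep g i k)) (crd i p)).
  apply: near_eq_is_diff; last exact: (@ex_diff _ _ _ _ _ _ _ d12).
  apply: filterS nD => x Dx.
  by rewrite (@rep_pair i (j, k) x Dx) row_mx_sum.
apply: (jacobianP H) => v; rewrite (@diff_val _ _ _ _ _ _ _ d12).
by rewrite mul_mx_row row_mx_sum /= !mul_jacobian.
Qed.

End Pairing.

Section ConstId.
Context {m n : nat} {S T : Type} {A : atlas R m S} {B : atlas R n T}.
Hypothesis sA : separating A.
Hypothesis idA : smooth A A id.

Lemma open_chart_image (i : idx A) : open (crd i @` dom i).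
Proof.
have [+ _] := idA i i; rewrite /local_dom.
by have -> : dom i `&` id @^-1` dom i = dom i by rewrite preimage_id setIid.
Qed.

Let rep_const (c : T) (i : idx A) (j : idx B) x :
  local_dom (A := A) (B := B) (fun=> c) i j x ->
  local_rep (A := A) (B := B) (fun=> c) i j x = crd j c.
Proof. by move=> [p [ip jc] <-]; rewrite (local_repE sA). Qed.

Let open_const (c : T) (i : idx A) (j : idx B) :
  open (local_dom (A := A) (B := B) (fun=> c) i j).
Proof.
have [jc|njc] := pselect (dom j c).
  rewrite (_ : local_dom _ _ _ = crd i @` dom i); first exact: open_chart_image.
  apply/seteqP; split=> [x [p [ip _] <-]|x [p ip <-]]; first by exists p.
  by exists p.
rewrite (_ : local_dom _ _ _ = set0); first exact: open0.
by apply/seteqP; split=> [x [p []]|].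
Qed.

Lemma smooth_const (c : T) : smooth A B (fun=> c).
Proof.
move=> i j; split=> [|r]; first exact: open_const.
apply: (@cont_diff_ext _ _ _ _ _ (fun=> crd j c)); first exact: open_const.
  by move=> x; rewrite inE => /rep_const ->.
exact: cont_diff_cst.
Qed.

Lemma jac_const (c : T) (i : idx A) (j : idx B) p : dom i p -> dom j c ->
  jac (A := A) (B := B) (fun=> c) i j p = 0.
Proof.
move=> ip jc; have Dp : local_dom (A := A) (B := B) (fun=> c) i j (crd i p).
  exact/(local_domP sA).
have H : is_diff (crd i p) (local_rep (A := A) (B := B) (fun=> c) i j)
    ('d (cst (crd j c)) (crd i p)).
  have nD : \forall x \near crd i p, local_dom (A := A) (B := B) (fun=> c) i j x.
    by apply: open_nbhs_nbhs; split; [exact: open_const|exact: Dp].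
  apply: near_eq_is_diff; last exact: differentiable_cst.
  by apply: filterS nD => x /rep_const ->.
by apply: (jacobianP H) => v; rewrite diff_cst mulmx0.
Qed.

Lemma jac_id (i : idx A) p : dom i p -> jac (A := A) (B := A) id i i p = 1%:M.
Proof.
move=> ip; have H : is_diff (crd i p) (local_rep (A := A) (B := A) id i i)
    ('d id (crd i p)).
  have nD : \forall x \near crd i p, (crd i @` dom i) x.
    by apply: open_nbhs_nbhs; split; [exact: open_chart_image|exists p].
  apply: near_eq_is_diff; last exact: ex_diff.
  by apply: filterS nD => x [q iq <-]; rewrite (local_repE sA).
by apply: (jacobianP H) => v; rewrite mulmx1 diff_val.
Qed.

End ConstId.

Lemma separating_mfd n (T : topologicalType) (A : manifold R n T) : separating A.
Proof. by move=> i p q ip iq; apply: (chart_inj (m := A) (i := i)); rewrite inE. Qed.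

Lemma covering_mfd n (T : topologicalType) (A : manifold R n T) : covering A.
Proof. exact: chart_cover. Qed.

Lemma smooth_id_mfd n (T : topologicalType) (A : manifold R n T) : smooth A A id.
Proof.
move=> i j; split; last exact: chart_compatible.
apply: chart_open; last by move=> p [].
by apply: openI; [exact: chart_dom_open|rewrite preimage_id; exact: chart_dom_open].
Qed.

End Jacobians.

(** * Tangent spaces and tangent maps *)

Section TangentSpaces.
Context {R : realType}.

(** The part of the manifold axioms on which tangent maps depend; it is satisfied
    by manifolds and by the one-chart atlas of R^n. *)
Definition regular n T (A : atlas R n T) :=
  [/\ covering A, separating A & smooth A A id].

Lemma regular_mfd n (T : topologicalType) (A : manifold R n T) : regular A.
Proof.
split; [exact: covering_mfd|exact: separating_mfd|exact: smooth_id_mfd].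
Qed.

Lemma regular_euclid n : regular (euclid R n).
Proof.
have sE : separating (euclid R n) by [].
split => //; first by move=> p; exists tt.
move=> [] [].
have -> : local_dom (A := euclid R n) (B := euclid R n) id tt tt = setT.
  by apply/seteqP; split=> // x _; exists x.
split; first exact: openT.
move=> r; apply: (@cont_diff_ext _ _ _ _ _ id); first exact: openT.
  move=> x _; symmetry.
  exact: (@local_repE R n n _ _ (euclid R n) (euclid R n) sE id tt tt x).
exact: cont_diff_id.
Qed.

Definition change n T (A : atlas R n T) (i j : idx A) (p : T) : 'M[R]_n :=
  jac (A := A) (B := A) id i j p.

Section OneAtlas.
Context {n : nat} {T : Type} {A : atlas R n T}.
Hypothesis rA : regular A.

Lemma change_trans (i j k : idx A) p : dom i p -> dom j p -> dom k p ->
  change i k p = change i j p *m change j k p.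
Proof.
case: rA => cA sA idA ip jp kp.
exact: (jac_compose sA sA idA idA ip jp kp).
Qed.

Lemma change_id (i : idx A) p : dom i p -> change i i p = 1%:M.
Proof. by case: rA => cA sA idA ip; exact: jac_id. Qed.

Lemma change_unit (i j : idx A) p : dom i p -> dom j p -> change i j p \in unitmx.
Proof.
move=> ip jp; apply: (mulmx1_unit (B := change j i p) _).1.
by rewrite -change_trans// change_id.
Qed.

Lemma tspace_change p v (i j : idx A) : tspace A p v -> dom i p -> dom j p ->
  v j = v i *m change i j p.
Proof. by move=> [_ H] ip jp; rewrite /change /jac mul_jacobian; exact: H. Qed.

Lemma tspace_inj p u v (i : idx A) : tspace A p u -> tspace A p v -> dom i p ->
  u i = v i -> u = v.
Proof.
move=> tu tv ip uv; apply/funext => j.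
have [jp|njp] := pselect (dom j p).
  by rewrite (tspace_change tu ip jp) (tspace_change tv ip jp) uv.
by rewrite (tu.1 _ njp) (tv.1 _ njp).
Qed.

Definition tangent_of (i : idx A) (p : T) (w : 'rV[R]_n) : tvec A :=
  fun j => if pselect (dom j p) then w *m change i j p else 0.

Lemma tangent_of_tspace (i : idx A) p w : dom i p -> tspace A p (tangent_of i p w).
Proof.
move=> ip; split=> [j njp|j k jp kp]; rewrite /tangent_of.
  by case: pselect.
case: pselect => // kp'; case: pselect => // jp'.
by rewrite -mul_jacobian -/(jac (A := A) (B := A) id j k p) -mulmxA (change_trans ip jp kp).
Qed.

Lemma tangent_ofE (i : idx A) p w : dom i p -> tangent_of i p w i = w.
Proof.
by move=> ip; rewrite /tangent_of; case: pselect => // ip'; rewrite change_id ?mulmx1.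
Qed.

Lemma tvec_sumE d (c : 'I_d -> R) (b : 'I_d -> tvec A) (i : idx A) :
  (\sum_l c l *: b l) i = \sum_l c l *: b l i.
Proof. by rewrite fct_sumE. Qed.

Lemma tspace_sum d (c : 'I_d -> R) (b : 'I_d -> tvec A) p :
  (forall l, tspace A p (b l)) -> tspace A p (\sum_l c l *: b l).
Proof.
move=> tb; split=> [i nip|i j ip jp]; rewrite !tvec_sumE.
  apply: big1 => l _; have [b0 _] := tb l.
  by rewrite (b0 i nip) scaler0.
rewrite linear_sum; apply: eq_bigr => l _.
by rewrite linearZ ((tb l).2 _ _ ip jp).
Qed.

End OneAtlas.

Section TangentMaps.
Context {m n : nat} {S T : Type} {A : atlas R m S} {B : atlas R n T}.
Hypotheses (rA : regular A) (rB : regular B).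
Variable f : S -> T.
Hypothesis sf : smooth A B f.

Lemma jac_change_dom (i i' : idx A) (j : idx B) p :
  dom i p -> dom i' p -> dom j (f p) ->
  jac f i j p = change i i' p *m jac f i' j p.
Proof.
case: rA => cA sA idA ip ip' jfp.
exact: (jac_compose sA sA idA sf ip ip' jfp).
Qed.

Lemma jac_change_cod (i : idx A) (j j' : idx B) p :
  dom i p -> dom j (f p) -> dom j' (f p) ->
  jac f i j' p = jac f i j p *m change j j' (f p).
Proof.
case: rA => cA sA idA; case: rB => cB sB idB ip jfp jfp'.
exact: (jac_compose sA sB sf idB ip jfp jfp').
Qed.

(** The tangent map may be computed in any chart at p: the Jacobian of a change of
    chart relates both the components of v and the Jacobians of f. *)
Lemma tmapE p v (i : idx A) (j : idx B) : tspace A p v -> dom i p -> dom j (f p) ->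
  tmap A B f p v j = v i *m jac f i j p.
Proof.
move=> tv ip jfp; rewrite /tmap; set X := (X in xget 0 X).
have : X (xget 0 X).
  by apply: xgetPex; exists (v i *m jac f i j p); exists i; rewrite -mul_jacobian.
move=> [i' [ip' _ ->]]; rewrite -mul_jacobian -/(jac f i' j p).
by rewrite (tspace_change tv ip ip') -mulmxA -jac_change_dom.
Qed.

Lemma tmap_out p v (j : idx B) : ~ dom j (f p) -> tmap A B f p v j = 0.
Proof.
move=> njfp; rewrite /tmap; case: xgetP => // y _ [i [_ jfp]].
by case: njfp.
Qed.

Lemma tmap_tspace p v : tspace A p v -> tspace B (f p) (tmap A B f p v).
Proof.
move=> tv; have [cA _ _] := rA; have [i ip] := cA p.
split=> [j njp|j k jp kp]; first exact: tmap_out.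
rewrite !(tmapE tv ip)// -mul_jacobian -/(jac (A := B) (B := B) id j k (f p)).
by rewrite (jac_change_cod ip jp kp) mulmxA.
Qed.

Lemma tmap_eq0 p v (i : idx A) (j : idx B) : tspace A p v -> dom i p -> dom j (f p) ->
  v i *m jac f i j p = 0 <-> tmap A B f p v = 0.
Proof.
move=> tv ip jfp; split=> [v0|/(congr1 (fun u => u j))]; last first.
  by rewrite (tmapE tv ip jfp).
apply/funext => j'; have [jfp'|njfp] := pselect (dom j' (f p)); last first.
  by rewrite tmap_out.
by rewrite (tmapE tv ip jfp') (jac_change_cod ip jfp jfp') mulmxA v0 mul0mx.
Qed.

End TangentMaps.

End TangentSpaces.

(** * Dimensions of subspaces of a tangent space *)

Section Dimension.
Context {R : realType}.

Section Basis.
Context {n : nat} {T : Type} {A : atlas R n T} (rA : regular A).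
Variables (p : T) (i : idx A).
Hypothesis ip : dom i p.
Implicit Type W : set (tvec A).

Definition components d (b : 'I_d -> tvec A) : 'M[R]_(d, n) := \matrix_l b l i.

Lemma mul_components d (b : 'I_d -> tvec A) (u : 'rV[R]_d) :
  u *m components b = (\sum_l u 0 l *: b l) i.
Proof.
rewrite tvec_sumE mulmx_sum_row; apply: eq_bigr => l _.
by rewrite rowK.
Qed.

(** Through components in one chart, dimensions of subspaces of the tangent space
    become ranks of matrices. *)
Lemma basis_mx d (b : 'I_d -> tvec A) W : W `<=` tspace A p -> is_basis b W ->
  row_free (components b) /\
  (forall v, tspace A p v -> W v <-> (v i <= components b)%MS).
Proof.
move=> WT [bW bU].
have Wb l : W (b l).
  have := bW (fun l' => (l' == l)%:R).
  rewrite (bigD1 l)//= eqxx scale1r big1 ?addr0// => l' /negPf ->.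
  by rewrite scale0r.
have tb l : tspace A p (b l) by exact/WT/Wb.
split.
  apply: inj_row_free => u; rewrite mul_components => u0.
  have W0 : W 0.
    by have := bW (fun=> 0); rewrite big1// => l _; rewrite scale0r.
  have [c [_ cU]] := bU 0 W0.
  have E1 : c = (fun=> 0) by apply: cU; rewrite big1// => l _; rewrite scale0r.
  have E2 : c = u 0.
    have t1 := WT _ W0; apply: cU => /=.
    have t2 := tspace_sum (fun l => u 0 l) tb.
    by apply: (tspace_inj t1 t2 ip); rewrite /= u0.
  by apply/rowP => l; rewrite -E2 E1 mxE.
move=> v tv; split=> [/bU[c [-> _]]|/submxP[u vu]].
  have -> : (\sum_l c l *: b l) i = (\row_l c l) *m components b.
    by rewrite mul_components; congr (_ i); apply: eq_bigr => l _; rewrite mxE.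
  exact: submxMl.
rewrite mul_components in vu.
have -> : v = \sum_l u 0 l *: b l.
  exact: (tspace_inj tv (tspace_sum (fun l => u 0 l) tb) ip vu).
exact: bW.
Qed.

Lemma mx_basis W q (K : 'M[R]_(q, n)) : W `<=` tspace A p ->
  (forall v, tspace A p v -> W v <-> (v i <= K)%MS) ->
  exists b : 'I_(\rank K) -> tvec A, is_basis b W.
Proof.
move=> WT WK; pose B := row_base K.
pose b l := tangent_of i p (row l B).
have tb l : tspace A p (b l) by exact: tangent_of_tspace.
have bB : components b = B.
  by apply/row_matrixP => l; rewrite rowK /b tangent_ofE.
have sumE c : (\sum_l c l *: b l) i = (\row_l c l) *m B.
  by rewrite -bB mul_components; congr (_ i); apply: eq_bigr => l _; rewrite mxE.
exists b; split=> [c|v Wv].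
  apply/WK; first exact: tspace_sum.
  by rewrite sumE (submx_trans (submxMl _ _))// eq_row_base.
have tv := WT _ Wv.
have : (v i <= B)%MS by rewrite eq_row_base; exact/WK.
move=> /submxP[u vu]; exists (u 0); split.
  apply: (tspace_inj tv (tspace_sum (fun l => u 0 l) tb) ip).
  by rewrite vu -bB mul_components.
move=> c vc; have : u *m B = (\row_l c l) *m B by rewrite -vu vc sumE.
move=> /(row_free_inj (row_base_free K)) ->.
by apply/funext => l; rewrite mxE.
Qed.

Lemma vdim_mx W q (K : 'M[R]_(q, n)) : W `<=` tspace A p ->
  (forall v, tspace A p v -> W v <-> (v i <= K)%MS) -> vdim W = \rank K.
Proof.
move=> WT WK; rewrite /vdim; set X := (X in xget _ X).
have : X (xget 0%N X).
  by apply: xgetPex; exists (\rank K); exact: (mx_basis WT WK).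
move: (xget _ _) => d [b /(basis_mx WT)[fb Wb]].
move: fb; rewrite /row_free => /eqP <-.
have H (u : 'rV[R]_n) : (u <= components b)%MS = (u <= K)%MS.
  have tu := tangent_of_tspace rA u ip.
  rewrite -(tangent_ofE rA u ip).
  by apply/idP/idP => [/(Wb _ tu).2 /(WK _ tu).1|/(WK _ tu).2 /(Wb _ tu).1].
by apply: eqmx_rank; apply/andP; split; apply/row_subP => l;
  [rewrite -H|rewrite H]; exact: row_sub.
Qed.

(** Take a row-free matrix with rows in W and as many rows as possible. *)
Lemma subspace_mx (W : set 'rV[R]_n) : W 0 ->
  (forall a u v, W u -> W v -> W (a *: u + v)) ->
  exists d (B : 'M[R]_(d, n)), forall u, W u <-> (u <= B)%MS.
Proof.
move=> W0 Wlin.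
pose P d := `[< exists B : 'M[R]_(d, n), row_free B /\ forall l, W (row l B) >].
have P0 : exists d, P d.
  exists 0%N; apply/asboolP; exists 0; split; last by case.
  by rewrite /row_free mxrank0.
have ub d : P d -> (d <= n)%N.
  by move=> /asboolP[B [/eqP rB _]]; rewrite -[X in (X <= _)%N]rB rank_leq_col.
have [d /asboolP[B [fB BW]] dmax] := ex_maxnP P0 ub.
exists d, B => u; split=> [Wu|/submxP[c ->]].
  apply: contraT => nuB.
  suff : P d.+1 by move=> /dmax; rewrite ltnn.
  rewrite -addn1; apply/asboolP; exists (col_mx B u); split.
    apply: inj_row_free => w; rewrite -[w]hsubmxK mul_row_col => w0.
    have wr : rsubmx w = 0.
      apply/eqP; apply: contraR nuB => wr0.
      have wE : rsubmx w = (rsubmx w 0 0)%:M by exact: mx11_scalar.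
      have w00 : rsubmx w 0 0 != 0.
        by apply: contra wr0 => /eqP w00; rewrite wE w00 raddf0.
      have : rsubmx w *m u = - (lsubmx w *m B) by apply/eqP; rewrite -addr_eq0 addrC w0.
      rewrite wE mul_scalar_mx => /(congr1 ( *:%R (rsubmx w 0 0)^-1)).
      rewrite scalerA mulVf// scale1r => ->.
      by rewrite -mulNmx scalemxAl submxMl.
    move: w0; rewrite wr mul0mx addr0 -[RHS](mul0mx _ B) => /(row_free_inj fB) ->.
    by rewrite row_mx0.
  move=> l; case: (split_ordP l) => j ->; first by rewrite rowKu.
  by rewrite rowKd row_id.
rewrite mulmx_sum_row; elim/big_ind: _ => // [x y Wx Wy|l _].
  by rewrite -[x]scale1r; exact: Wlin.
by rewrite -[_ *: _]addr0; exact: Wlin.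
Qed.

End Basis.
End Dimension.

(** * Orbit maps and stabilizers *)

Section OrbitMaps.
Context {R : realType}.

Lemma jac_diffeo m S (A : atlas R m S) (f g : S -> S) (i j : idx A) p :
  regular A -> smooth A A f -> smooth A A g -> (forall p, g (f p) = p) ->
  dom i p -> dom j (f p) -> jac (A := A) (B := A) f i j p \in unitmx.
Proof.
move=> rA sf sg gf ip jfp; have [cA sA idA] := rA.
have igfp : dom i (g (f p)) by rewrite gf.
apply: (mulmx1_unit (B := jac (A := A) (B := A) g j i (f p)) _).1.
rewrite -(jac_compose sA sA sf sg ip jfp igfp).
by rewrite (_ : (fun p => g (f p)) = id) ?jac_id//; apply/funext.
Qed.

Context {n m k : nat} {M N : topologicalType} {O : topologicalGroupCarrier}.
Context {AM : manifold R n M} {AN : manifold R m N} {AO : lie_group R k O}.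
Variable lam : s_space AM AN AO.

Let sNO : separating (prod_atlas AN AO).
Proof. by apply: separating_prod; exact: separating_mfd. Qed.
Let cNO : covering (prod_atlas AN AO).
Proof. by apply: covering_prod; exact: covering_mfd. Qed.
Let sN : separating AN. Proof. exact: separating_mfd. Qed.
Let sO : separating AO. Proof. exact: separating_mfd. Qed.
Let rN : regular AN. Proof. exact: regular_mfd. Qed.
Let rO : regular AO. Proof. exact: regular_mfd. Qed.
Let idN : smooth AN AN id. Proof. exact: smooth_id_mfd. Qed.
Let idO : smooth AO AO id. Proof. exact: smooth_id_mfd. Qed.

Lemma smooth_orbit z : smooth AO AN (act lam z).
Proof.
exact: (smooth_compose sO sNO cNO
  (smooth_pair sO (smooth_const sO idO z) idO) (act_smooth lam)).
Qed.

(** The derivative of the orbit map of z is a partial derivative of the action,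
    hence depends smoothly on z. *)
Lemma jac_orbit z a (j : idx AO) (i i' : idx AN) :
  dom j a -> dom i' z -> dom i (act lam z a) ->
  jac (A := AO) (B := AN) (act lam z) j i a =
  row_mx 0 1%:M *m
  jac (A := prod_atlas AN AO) (B := AN) (fun za => act lam za.1 za.2) (i', j) i (z, a).
Proof.
move=> ja iz iza.
have sp := smooth_pair sO (smooth_const (B := AN) sO idO z) idO.
have -> : row_mx 0 1%:M = jac (A := AO) (B := prod_atlas AN AO) (fun b => (z, id b)) j (i', j) a.
  rewrite (jac_pair sO (smooth_const (B := AN) sO idO z) idO)//.
  by rewrite jac_const// jac_id.
exact: (jac_compose sO sNO sp (act_smooth lam)).
Qed.

Lemma smooth_act a : smooth AN AN (act lam ^~ a).
Proof.
exact: (smooth_compose sN sNO cNO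
  (smooth_pair sN idN (smooth_const sN idN a)) (act_smooth lam)).
Qed.

Lemma smooth_rmul (a : O) : smooth AO AO (fun b => (b * a)%g).
Proof.
have sp := smooth_pair sO idO (smooth_const (B := AO) sO idO a).
have sOO := separating_prod sO sO.
have cOO := covering_prod (covering_mfd AO) (covering_mfd AO).
exact: (smooth_compose sO sOO cOO sp (@lie_mul_smooth _ _ _ AO)).
Qed.

(** As z.(ba) = (z.b).a, the derivatives of the orbit map at 1 and at a differ by
    the derivatives of two diffeomorphisms, the translations by a in O and in
    N. *)
Lemma rank_jac_orbit z a (j0 j : idx AO) (i0 i : idx AN) :
  dom j0 1%g -> dom i0 z -> dom j a -> dom i (act lam z a) ->
  \rank (jac (A := AO) (B := AN) (act lam z) j i a) =
  \rank (jac (A := AO) (B := AN) (act lam z) j0 i0 1%g).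
Proof.
move=> j1 iz ja iza.
have j1a : dom j (1 * a)%g by rewrite mul1g.
have iz1 : dom i0 (act lam z 1%g) by rewrite act1.
have iza1 : dom i (act lam (act lam z 1%g) a) by rewrite act1.
have iz1a : dom i (act lam z (1 * a)%g) by rewrite mul1g.
have E1 := jac_compose sO sO (smooth_rmul a) (smooth_orbit z) j1 j1a iz1a.
have E2 := jac_compose sO sN (smooth_orbit z) (smooth_act a) j1 iz1 iza1.
have uO : jac (A := AO) (B := AO) (fun b => (b * a)%g) j0 j 1%g \in unitmx.
  apply: (jac_diffeo rO (smooth_rmul a) (smooth_rmul a^-1%g)) => // b.
  by rewrite mulgK.
have uN : jac (A := AN) (B := AN) (act lam ^~ a) i0 i (act lam z 1%g) \in unitmx.
  apply: (jac_diffeo rN (smooth_act a) (smooth_act a^-1%g)) => // y.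
  by rewrite actM mulgV act1.
have Ef : (fun b => act lam z (b * a)%g) = (fun b => act lam (act lam z b) a).
  by apply/funext => b; rewrite actM.
have E12 := congr1 (fun f => jac (A := AO) (B := AN) f j0 i 1%g) Ef.
have := congr1 (fun X : 'M[R]_(k, m) => \rank X) (etrans (esym E1) (etrans E12 E2)).
have fN : row_free (jac (A := AN) (B := AN) (act lam ^~ a) i0 i (act lam z 1%g)).
  by rewrite row_free_unit.
by rewrite (mxrank_unitl _ uO) (mxrankMfree _ fN) mul1g.
Qed.

Lemma rank_rep_orbit z (j0 j : idx AO) (i0 i : idx AN) x :
  dom j0 1%g -> dom i0 z -> local_dom (A := AO) (B := AN) (act lam z) j i x ->
  \rank ('J (local_rep (A := AO) (B := AN) (act lam z) j i) x) =
  \rank (jac (A := AO) (B := AN) (act lam z) j0 i0 1%g).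
Proof. by move=> j1 iz [a [ja iza] <-]; exact: rank_jac_orbit. Qed.

Lemma lift_curve (j : idx AO) (c : 'rV[R]_1 -> 'rV[R]_k) :
  smooth_on setT c -> (forall t, (crd j @` dom j) (c t)) ->
  exists g : 'rV[R]_1 -> O, [/\ smooth (euclid R 1) AO g,
    forall t, dom j (g t) & forall t, crd j (g t) = c t].
Proof.
move=> sc cD.
have /choice[g gP] : forall t, exists a, dom j a /\ crd j a = c t.
  by move=> t; have [a ja ac] := cD t; exists a.
exists g; split; [|by move=> t; have [] := gP t|by move=> t; have [] := gP t].
have [cE sE idE] := regular_euclid (R := R) 1.
move=> [] j'.
have domE : local_dom (A := euclid R 1) (B := AO) g tt j' =
    setT `&` c @^-1` (local_dom (A := AO) (B := AO) id j j').
  apply/seteqP; split=> [t [s [_ j's] <-]|t [_ [a [ja j'a] ac]]].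
    split => //; exists (g s); last by have [] := gP s.
    by split => //; have [] := gP s.
  exists t => //; split => //; have [jg gc] := gP t.
  by rewrite /= (_ : g t = a)//; apply: (sO jg ja); rewrite gc ac.
have [od sd] := idO j j'.
have oD : open (local_dom (A := euclid R 1) (B := AO) g tt j').
  by rewrite domE; exact: (open_preimage_on openT od (sc 0%N)).
split => // r.
apply: (@cont_diff_ext _ _ _ _ _ (fun t => local_rep (A := AO) (B := AO) id j j' (c t))) => //.
  move=> t; rewrite inE => -[s [_ j's] <-]; have [jg gc] := gP s.
  rewrite [RHS](local_repE (A := euclid R 1) (B := AO) sE (i := tt) (j := j') I j's).
  by rewrite [X in local_rep _ _ _ X]/= -gc (local_repE sO).
apply: (cont_diff_comp (U' := local_dom (A := AO) (B := AO) id j j')) (sd r) => //.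
  by move=> t; rewrite domE => -[].
by apply: cont_diff_sub (sc r).
Qed.

Lemma velocity_tspace :
  tspace (euclid R 1) (0 : 'rV[R]_1) (fun _ => const_mx 1).
Proof.
have rE := regular_euclid (R := R) 1.
split=> [i /(_ I)[]//|[] [] _ _].
rewrite -mul_jacobian -/(jac (A := euclid R 1) (B := euclid R 1) id tt tt 0).
by case: rE => cE sE idE; rewrite (jac_id sE idE) ?mulmx1.
Qed.

(** The velocity of a curve in the stabilizer is killed by the chain rule.
    Conversely the orbit map has constant rank, so every vector killed by its
    derivative at 1 is the velocity of a curve in its level set through 1, which
    is the stabilizer of z. *)
Lemma stabilizer_tspaceP z (j : idx AO) (i : idx AN) v :
  dom j 1%g -> dom i z ->
  stabilizer_tspace lam z v <->
  tspace AO 1%g v /\ v j *m jac (A := AO) (B := AN) (act lam z) j i 1%g = 0.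
Proof.
move=> j1 iz; have iz1 : dom i (act lam z 1%g) by rewrite act1.
have rE := regular_euclid (R := R) 1; have [cE sE idE] := rE.
have t0 := velocity_tspace.
split=> [[c [sc c0 cS ->]]|[tv vJ0]].
  have tc := tmap_tspace rE rO sc t0; rewrite c0 in tc; split=> //.
  have jc0 : dom j (c 0) by rewrite c0.
  have izc : dom i (act lam z (c 0)) by rewrite c0 act1.
  rewrite (tmapE rE sc t0 (i := tt) I jc0) -mulmxA -c0.
  rewrite -(jac_compose sE sO sc (smooth_orbit z) (i := tt) I jc0 izc).
  rewrite (_ : (fun t => act lam z (c t)) = (fun=> z)).
    by rewrite (jac_const sE idE)// mulmx0.
  by apply/funext => t; exact: cS.
have [oU sU] := smooth_orbit z j i.
have U1 : local_dom (A := AO) (B := AN) (act lam z) j i (crd j 1%g) by exists 1%g.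
have [c [sc c0 cU cz dc]] := level_curve oU sU U1
  (fun x Ux => rank_rep_orbit j1 iz Ux) vJ0.
have [g [sg jg gc]] := lift_curve sc (fun t => let: ex_intro2 a (conj ja _) ac := cU t in
   ex_intro2 _ _ a ja ac).
have g0 : g 0 = 1%g by apply: (sO (jg 0) j1); rewrite gc.
have jg0 : dom j (g 0) by rewrite g0.
exists g; split => //.
  move=> t; rewrite /stabilizer /=.
  have izg : dom i (act lam z (g t)).
    by apply/(local_domP sO (act lam z) i (jg t)); rewrite gc.
  apply: (sN izg iz); rewrite -(local_repE sO (jg t) izg) gc cz.
  by rewrite (local_repE sO)// act1.
have tg := tmap_tspace rE rO sg t0; rewrite g0 in tg.
apply: (tspace_inj tv tg j1).
have cE' : c = local_rep (A := euclid R 1) (B := AO) g tt j.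
  apply/funext => t; rewrite -gc.
  by have := local_repE (A := euclid R 1) (B := AO) sE (i := tt) I (jg t).
rewrite (tmapE rE sg t0 (i := tt) I jg0) /jac -cE' mul_jacobian.
by rewrite -dc.
Qed.

End OrbitMaps.

(** * The rank of an orbit map *)

Section OrbitRank.
Context {R : realType}.

(** Countably many of the neighborhoods on which f has nowhere dense image cover
    D; they can be chosen in a countable basis. *)
Lemma Baire_image (X : topologicalType) d (D : set X) (f : X -> 'rV[R]_d)
    (b : 'rV[R]_d) (e : R) :
  second_countable (T := X) -> 0 < e ->
  (forall x, D x -> exists F : set 'rV[R]_d,
     (forall (c : 'rV[R]_d) (r : R), 0 < r -> ~ ball c r `<=` closure F) /\
     \forall y \near x, D y -> F (f y)) ->
  ~ ball b e `<=` f @` D.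
Proof.
move=> [B /countable_injP[code codeI] [_ Bb]] e0 Hf cov.
pose small (F : set 'rV[R]_d) :=
  forall (c : 'rV[R]_d) (r : R), 0 < r -> ~ ball c r `<=` closure F.
have small0 : small set0.
  by move=> c r r0; rewrite closure0 => /(_ c (ballxx _ r0)).
pose good n F := small F /\
  exists V, [/\ B V, code V = n & forall y, V y -> D y -> F (f y)].
(* F n is a nowhere dense set containing the image of the basic open set of code
   n, when there is one. *)
pose F n := if pselect (exists F, good n F) is left H then projT1 (cid H) else set0.
have smallF n : small (F n).
  rewrite /F; case: pselect => [H|_]; last exact: small0.
  by case: (cid H) => G [].
apply: (Baire_rV (F := F) (b := b) e0); first by move=> n c r r0; exact: smallF.
move=> _ /cov[x Dx <-].
have [G [sG nG]] := Hf x Dx.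
have [V [BV Vx] VG] := Bb x _ nG.
exists (code V) => //; rewrite /F; case: pselect => [H|nH]; last first.
  by case: nH; exists G; split => //; exists V.
case: (cid H) => G' [sG' [V' [BV' cV' V'G']]] /=.
by apply: V'G' => //; rewrite (codeI V' V) ?inE.
Qed.

Context {n m k : nat} {M N : topologicalType} {O : topologicalGroupCarrier}.
Context {AM : manifold R n M} {AN : manifold R m N} {AO : lie_group R k O}.
Variable lam : s_space AM AN AO.

Let sN : separating AN. Proof. exact: separating_mfd. Qed.
Let sO : separating AO. Proof. exact: separating_mfd. Qed.
Let rM : regular AM. Proof. exact: regular_mfd. Qed.
Let rN : regular AN. Proof. exact: regular_mfd. Qed.
Let idO : smooth AO AO id. Proof. exact: smooth_id_mfd. Qed.

Lemma rank_jac_proj z (i : idx AN) (q : idx AM) :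
  dom i z -> dom q (Defs.proj lam z) ->
  \rank (jac (A := AN) (B := AM) (Defs.proj lam) i q z) = n.
Proof.
move=> iz qz; apply/eqP; rewrite -/(row_full _) -sub1mx; apply/row_subP => l.
set w := row l _.
have tw := tangent_of_tspace rM w qz.
have : (tmap AN AM (Defs.proj lam) z @` tspace AN z) (tangent_of q (Defs.proj lam z) w).
  by rewrite proj_submersion.
move=> [v tv /(congr1 (fun u => u q))].
rewrite (tmapE rN (proj_smooth lam) tv iz qz) tangent_ofE// => <-.
exact: submxMl.
Qed.

Lemma jac_orbit_proj z (j : idx AO) (i : idx AN) (q : idx AM) :
  dom j 1%g -> dom i z -> dom q (Defs.proj lam z) ->
  jac (A := AO) (B := AN) (act lam z) j i 1%g *m
  jac (A := AN) (B := AM) (Defs.proj lam) i q z = 0.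
Proof.
move=> j1 iz qz.
have iz1 : dom i (act lam z 1%g) by rewrite act1.
have qz1 : dom q (Defs.proj lam (act lam z 1%g)) by rewrite act1.
have := jac_compose sO sN (smooth_orbit lam z) (proj_smooth lam) j1 iz1 qz1.
rewrite act1 => <-.
rewrite (_ : (fun a => Defs.proj lam (act lam z a)) = (fun=> Defs.proj lam z)).
  by rewrite jac_const.
by apply/funext => a; exact: act_fiber.
Qed.

(** The rank is at most m - n because the projection is constant on orbits.  If it
    were smaller, the fiber, which is the image of the orbit map, would be a
    countable union of pieces of dimension less than m - n; but an affine map sends
    a part of the fiber onto a ball of dimension m - n. *)
Lemma rank_orbit z (j : idx AO) (i : idx AN) :
  dom j 1%g -> dom i z ->
  \rank (jac (A := AO) (B := AN) (act lam z) j i 1%g) = (m - n)%N /\ (n <= m)%N.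
Proof.
move=> j1 iz; have [q qz] := @chart_cover _ _ _ AM (Defs.proj lam z).
have rk_proj := rank_jac_proj iz qz.
have nm : (n <= m)%N by rewrite -rk_proj rank_leq_row.
split => //; set r := \rank _.
have le : (r + n <= m)%N.
  by rewrite -{1}rk_proj; apply: mulmx0_rank_max; exact: jac_orbit_proj.
apply/eqP; rewrite eqn_leq -(leq_add2r n) subnK// le /=.
rewrite leqNgt; apply/negP => lt_r.
have [oU sU] := proj_smooth lam i q.
have U0 : local_dom (A := AN) (B := AM) (Defs.proj lam) i q (crd i z) by exists z.
have rkU x : local_dom (A := AN) (B := AM) (Defs.proj lam) i q x ->
    \rank ('J (local_rep (A := AN) (B := AM) (Defs.proj lam) i q) x) = n.
  by move=> [y [iy qy] <-]; exact: rank_jac_proj.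
have [P [rho [rho0 slice]]] := level_slice oU sU U0 rkU.
pose D := [set a : O | dom i (act lam z a)].
pose f a := (crd i (act lam z a) - crd i z) *m P.
apply: (@Baire_image O _ D f 0 rho (mfd_second_countable AO) rho0); last first.
  move=> t /ball_normP; rewrite subr0 => /slice[x [[y [iy qy] <-]]].
  rewrite !(local_repE sN)// => /(chart_inj (m := AM) (i := q)) pyz xP.
  have /(act_transitive (s := lam))[a za] : Defs.proj lam z = Defs.proj lam y.
    by rewrite pyz ?inE.
  by exists a; rewrite /D /f /= za.
move=> a Da; have [ja jaa] := @chart_cover _ _ _ AO a.
have [oV sV] := smooth_orbit lam z ja i.
have Va : local_dom (A := AO) (B := AN) (act lam z) ja i (crd ja a) by exists a.
have [g [d [K [d0 K0 gK gnear]]]] := local_image oV sV Va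
  (fun x Vx => rank_rep_orbit j1 iz Vx).
have [C C0 HC] := norm_mulmx_bound P.
pose h t := (g t - crd i z) *m P.
exists (h @` [set t | `|t| <= d]); split.
  move=> c e e0 cov.
  apply: (@lipschitz_image_nowhere_dense R r (m - n) h d (C * K) e c) => //.
  - by rewrite mulr_gt0.
  - move=> s t sd td; rewrite /h -mulmxBl opprB addrA subrK.
    by rewrite (le_trans (HC _))// -mulrA ler_pM2l// gK.
  - move=> y yc eta eta0.
    have /cov/(_ _ (nbhsx_ballx y eta eta0))[_ [[t td <-] yt]] : ball c e y.
      exact/ball_normP.
    by exists t => //; rewrite distrC; exact/ball_normP.
have ca : {for a, continuous (crd ja : O -> 'rV[R]_k)} by exact: chart_continuous.
have n1 : \forall b \near a, exists2 t, `|t| <= d &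
    local_rep (A := AO) (B := AN) (act lam z) ja i (crd ja b) = g t.
  exact: ca _ gnear.
have n2 : \forall b \near a, dom ja b.
  by apply: open_nbhs_nbhs; split => //; exact: chart_dom_open.
apply: filterS2 n1 n2 => b /= [t td ft] jb Db.
exists t => //; rewrite /h /f -ft; congr ((_ - _) *m _).
by rewrite (local_repE sO).
Qed.

End OrbitRank.

(** * Trivializing the tangent bundle by a frame *)

Section Trivialization.
Context {R : realType}.

Context {m : nat} {N : topologicalType} {AN : manifold R m N}.
Let sN : separating AN. Proof. exact: separating_mfd. Qed.
Let rN : regular AN. Proof. exact: regular_mfd. Qed.
Let idN : smooth AN AN id. Proof. exact: smooth_id_mfd. Qed.

Lemma tbundle_eq (x y : tbundle AN) :
  tb_pt x = tb_pt y -> tb_vec x = tb_vec y -> x = y.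
Proof.
case: x y => [[z v] zv] [[z' v'] zv'] /=; rewrite /tb_pt /tb_vec /= => zz' vv'.
by subst; congr exist; exact: Prop_irrelevance.
Qed.

Lemma tb_tspace (x : tbundle AN) : tspace AN (tb_pt x) (tb_vec x).
Proof. by case: x. Qed.

Lemma separating_tb : separating (tb_atlas AN).
Proof.
move=> i x y /= ix iy /eq_row_mx[exy vxy].
have pxy : tb_pt x = tb_pt y by exact: (sN ix iy).
apply: tbundle_eq => //; have ty := tb_tspace y; rewrite -pxy in ty.
exact: (tspace_inj (tb_tspace x) ty ix vxy).
Qed.

(** The rows of B i are the components, in the chart i, of the fields of a global
    frame. *)
Variable B : idx AN -> 'rV[R]_m -> 'M[R]_m.
Hypothesis sB : forall i, smooth_on (crd i @` dom i) (B i).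
Hypothesis uB : forall (i : idx AN) z, dom i z -> B i (crd i z) \in unitmx.
Hypothesis cB : forall (i j : idx AN) z, dom i z -> dom j z ->
  B j (crd j z) = B i (crd i z) *m change i j z.

Let ch (z : N) : idx AN := projT1 (cid (@chart_cover _ _ _ AN z)).
Let chP z : dom (ch z) z. Proof. exact: (projT2 (cid (@chart_cover _ _ _ AN z))). Qed.

Let fr z := B (ch z) (crd (ch z) z).
Let F (x : tbundle AN) : N * 'rV[R]_m :=
  (tb_pt x, tb_vec x (ch (tb_pt x)) *m invmx (fr (tb_pt x))).
Let G (zc : N * 'rV[R]_m) : tbundle AN :=
  exist (fun x : N * tvec AN => tspace AN x.1 x.2)
    (zc.1, tangent_of (ch zc.1) zc.1 (zc.2 *m fr zc.1))
    (tangent_of_tspace rN _ (chP zc.1)).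

Let FE x (i : idx AN) : dom i (tb_pt x) ->
  (F x).2 = tb_vec x i *m invmx (B i (crd i (tb_pt x))).
Proof.
move=> ix; set z := tb_pt x in ix *.
have cz := chP z; have u1 := uB ix; have u2 := uB cz.
rewrite /F /= -/z -/(fr z) (tspace_change (tb_tspace x) ix cz) -/z.
have -> : fr z = B i (crd i z) *m change i (ch z) z by exact: cB.
apply: (row_free_inj (A := B i (crd i z) *m change i (ch z) z)).
  by rewrite row_free_unit unitmx_mul u1 change_unit.
rewrite mulmxKV; last by rewrite unitmx_mul u1 change_unit.
by rewrite !mulmxA mulmxKV.
Qed.

Let GE zc (i : idx AN) : dom i zc.1 ->
  tb_vec (G zc) i = zc.2 *m B i (crd i zc.1).
Proof.
case: zc => z c /= iz; rewrite /tb_vec /=.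
have tG := tangent_of_tspace rN (c *m fr z) (chP z).
rewrite (tspace_change tG (chP z) iz) tangent_ofE; [|by []|exact: chP].
by rewrite -mulmxA /fr -cB.
Qed.

Let FK : cancel F G.
Proof.
move=> x; have cx := chP (tb_pt x).
apply: tbundle_eq => //; have tG : tspace AN (tb_pt x) (tb_vec (G (F x))).
  exact: tb_tspace (G (F x)).
apply: (tspace_inj tG (tb_tspace x) cx).
by rewrite GE// /F /= mulmxKV//; exact: uB.
Qed.

Let GK : cancel G F.
Proof.
move=> [z c]; have cz := chP z; congr (_, _).
rewrite -[LHS]/((F (G (z, c))).2) (FE (i := ch z))// GE//=.
by rewrite mulmxK//; exact: uB.
Qed.

(** Both F and G are identities on base points and linear on fibers, so the
    domains of their coordinate expressions only restrict the base point. *)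
Let over (i j : idx AN) : set 'rV[R]_(m + m) :=
  [set y | local_dom (A := AN) (B := AN) id i j (lsubmx y)].

Let over_open i j : open (over i j).
Proof.
have [od _] := idN i j.
have := open_preimage_on openT od (@cont_diff_lsubmx R m m 0 setT openT).
by rewrite setTI.
Qed.

Let smooth_over_base i j k :
  cont_diff k (over i j) (fun y => local_rep (A := AN) (B := AN) id i j (lsubmx y)).
Proof.
have [od cd] := idN i j; have oo := @over_open i j.
by apply: cont_diff_comp (cd k) => //; exact: cont_diff_lsubmx.
Qed.

Let domF (i j : idx AN) : local_dom (A := tb_atlas AN) (B := prod_atlas AN (euclid R m)) F i (j, tt) = over i j.
Proof.
apply/seteqP; split=> [_ [x [ix [/= jx _]] <-]|y [z [iz jz] zy]].
  by rewrite /over /= row_mxKl; exists (tb_pt x).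
pose x : tbundle AN := exist (fun x : N * tvec AN => tspace AN x.1 x.2)
    (z, tangent_of i z (rsubmx y)) (tangent_of_tspace rN _ iz).
exists x; first by split.
by rewrite /= /tb_vec /= tangent_ofE// /tb_pt /= zy hsubmxK.
Qed.

Let domG (i j : idx AN) : local_dom (A := prod_atlas AN (euclid R m)) (B := tb_atlas AN) G (i, tt) j = over i j.
Proof.
apply/seteqP; split=> [_ [[z c] [[/= iz _] /= jz] <-]|y [z [iz jz] zy]].
  by rewrite /over /= row_mxKl; exists z.
by exists (z, rsubmx y) => //=; rewrite zy hsubmxK.
Qed.

Let smoothF : smooth (tb_atlas AN) (prod_atlas AN (euclid R m)) F.
Proof.
suff H (i j : idx AN) : open (over i j) /\ smooth_on (over i j)
    (local_rep (A := tb_atlas AN) (B := prod_atlas AN (euclid R m)) F i (j, tt)).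
  by move=> i [j []]; rewrite domF; exact: H.
have oo := @over_open i j; split=> [//|k].
apply: (@cont_diff_ext _ _ _ _ _ (fun y =>
  row_mx (local_rep (A := AN) (B := AN) id i j (lsubmx y))
         (rsubmx y *m invmx (B i (lsubmx y))))) => //.
  move=> y; rewrite inE -domF => -[x [ix jx] <-].
  rewrite [RHS](@local_repE R _ _ _ _ (tb_atlas AN) (prod_atlas AN (euclid R m))
    separating_tb F i (j, tt) x ix jx).
  transitivity (row_mx (crd j (tb_pt x)) (F x).2); last by [].
  have ix' : dom i (tb_pt x) by exact: ix.
  have jx' : dom j (id (tb_pt x)) by case: jx.
  rewrite (_ : @crd _ _ _ (tb_atlas AN) i x = row_mx (crd i (tb_pt x)) (tb_vec x i))//.
  by rewrite row_mxKl row_mxKr (FE ix') (local_repE sN ix' jx').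
apply: (cont_diff_row_mx oo (@smooth_over_base i j k)).
apply: cont_diff_mulmx => //; first exact: cont_diff_rsubmx.
apply: cont_diff_invmx => //; first by move=> y [z [iz _] <-]; exact: uB.
apply: cont_diff_comp (sB i k) => //.
- exact: (open_chart_image idN).
- by move=> y [z [iz _] zy]; exists z.
- exact: cont_diff_lsubmx.
Qed.

Let smoothG : smooth (prod_atlas AN (euclid R m)) (tb_atlas AN) G.
Proof.
have sE : separating (euclid R m) by [].
suff H (i j : idx AN) : open (over i j) /\ smooth_on (over i j)
    (local_rep (A := prod_atlas AN (euclid R m)) (B := tb_atlas AN) G (i, tt) j).
  by move=> [i []] j; rewrite domG; exact: H.
have oo := @over_open i j; split=> [//|k].
apply: (@cont_diff_ext _ _ _ _ _ (fun y =>
  row_mx (local_rep (A := AN) (B := AN) id i j (lsubmx y))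
         (rsubmx y *m B j (local_rep (A := AN) (B := AN) id i j (lsubmx y))))) => //.
  move=> y; rewrite inE -domG => -[[z c] [[/= iz _] jz] <-].
  rewrite [RHS](@local_repE R _ _ _ _ (prod_atlas AN (euclid R m)) (tb_atlas AN)
    (separating_prod sN sE) G (i, tt) j (z, c) (conj iz I) jz).
  transitivity (row_mx (crd j z) (tb_vec (G (z, c)) j)); last by [].
  rewrite !row_mxKl row_mxKr GE//.
  by rewrite (local_repE sN (f := id) (i := i) (p := z) iz jz).
apply: (cont_diff_row_mx oo (@smooth_over_base i j k)).
apply: cont_diff_mulmx => //; first exact: cont_diff_rsubmx.
have oI : open (crd j @` dom j) by exact: (open_chart_image idN).
apply: (cont_diff_comp oo oI _ (@smooth_over_base i j k) (sB j k)).
by move=> y [z [iz jz] zy]; exists z => //; rewrite -zy (local_repE sN).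
Qed.

Lemma trivial_of_frame : trivial_tangent_bundle AN.
Proof.
exists F, G; split => // a x y w xw yw wxy.
have cw := chP (tb_pt w).
have cx : dom (ch (tb_pt w)) (tb_pt x) by rewrite xw.
have cy : dom (ch (tb_pt w)) (tb_pt y) by rewrite yw.
rewrite (FE cw) (FE cx) (FE cy) xw yw wxy.
by rewrite [in LHS]/GRing.add /= mulmxDl scalemxAl.
Qed.

End Trivialization.

(** * Vertical and horizontal frames *)

Section Frame.
Context {R : realType} {n d k : nat}.
Context {M N : topologicalType} {O : topologicalGroupCarrier}.
Context {AM : manifold R n M} {AN : manifold R (n + d) N} {AO : lie_group R k O}.
Variable lam : s_space AM AN AO.

Let sN : separating AN. Proof. exact: separating_mfd. Qed.
Let rM : regular AM. Proof. exact: regular_mfd. Qed.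
Let rN : regular AN. Proof. exact: regular_mfd. Qed.
Let rO : regular AO. Proof. exact: regular_mfd. Qed.
Let idN : smooth AN AN id. Proof. exact: smooth_id_mfd. Qed.
Let sP : smooth AN AM (Defs.proj lam). Proof. exact: (proj_smooth lam). Qed.

Local Notation Jp i q z := (jac (A := AN) (B := AM) (Defs.proj lam) i q z).
Local Notation Jo z j i := (jac (A := AO) (B := AN) (act lam z) j i 1%g).

Lemma vdim_stabilizer z (j : idx AO) : dom j 1%g ->
  vdim (stabilizer_tspace lam z) = (k - d)%N /\ (d <= k)%N.
Proof.
move=> j1; have [i iz] := @chart_cover _ _ _ AN z.
have [rk _] := rank_orbit lam j1 iz; rewrite addKn in rk.
split; last by rewrite -rk rank_leq_row.
have ST : stabilizer_tspace lam z `<=` tspace AO 1%g.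
  by move=> v /(stabilizer_tspaceP lam v j1 iz)[].
rewrite (vdim_mx (i := j) rO j1 (K := kermx (Jo z j i)) ST).
  by rewrite mxrank_ker rk.
move=> v tv; split=> [/(stabilizer_tspaceP lam v j1 iz)[_ v0]|/sub_kermxP v0].
  exact/sub_kermxP.
exact/(stabilizer_tspaceP lam v j1 iz).
Qed.

Lemma stabilizer_dimE (z : N) (j : idx AO) : dom j 1%g ->
  (k - stabilizer_dim lam)%N = d.
Proof.
move=> j1; rewrite /stabilizer_dim; set X := (X in xget 0%N X).
have : X (xget 0%N X) by apply: xgetPex; exists (vdim (stabilizer_tspace lam z)); exists z.
move=> [y _ <-]; have [-> dk] := vdim_stabilizer y j1.
by rewrite subKn.
Qed.

Variable V : set (tvec AO).
Hypothesis V_subspace : linear_subspace V.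
Hypothesis V_lie : V `<=` lie_algebra AO.

Lemma subspace_basis (j : idx AO) : dom j 1%g ->
  exists b : 'I_(vdim V) -> tvec AO, is_basis b V.
Proof.
move=> j1; pose W : set 'rV[R]_k := [set u | exists2 v, V v & v j = u].
have [V0 Vlin] := V_subspace.
have W0 : W 0 by exists 0.
have Wlin (a : R) u v : W u -> W v -> W (a *: u + v).
  move=> [u' Vu <-] [v' Vv <-]; exists (a *: u' + v') => //; exact: Vlin.
have [q [K KW]] := subspace_mx W0 Wlin.
have VK v : tspace AO 1%g v -> V v <-> (v j <= K)%MS.
  move=> tv; split=> [Vv|/KW[v' Vv' vv']]; first by apply/KW; exists v.
  by rewrite (tspace_inj tv (V_lie Vv') j1).
rewrite (vdim_mx rO j1 V_lie VK).
exact: (mx_basis rO j1 V_lie VK).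
Qed.

Section Vertical.
Variables (j : idx AO) (j1 : dom j 1%g) (b : 'I_d -> tvec AO).
Hypothesis b_basis : is_basis b V.

(** The rows are the components in the chart i of the fundamental fields of the
    b_l at the point of coordinates x.  Writing them through the Jacobian of the
    action, rather than of the orbit maps, shows their dependence on x. *)
Definition vertical_frame (i : idx AN) (x : 'rV[R]_(n + d)) : 'M[R]_(d, n + d) :=
  components j b *m (row_mx 0 1%:M *m
    'J (local_rep (A := prod_atlas AN AO) (B := AN)
          (fun za => act lam za.1 za.2) (i, j) i) (row_mx x (crd j 1%g))).

Lemma vertical_frameE (i : idx AN) z : dom i z ->
  vertical_frame i (crd i z) = components j b *m Jo z j i.
Proof.
move=> iz; have iz1 : dom i (act lam z 1%g) by rewrite act1.
by rewrite /vertical_frame (jac_orbit j1 iz iz1).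
Qed.

Lemma smooth_vertical_frame (i : idx AN) :
  smooth_on (crd i @` dom i) (vertical_frame i).
Proof.
move=> r; have oI : open (crd i @` dom i) by exact: (open_chart_image idN).
have [oD sD] := act_smooth lam (i, j) i.
apply: cont_diff_mulmx => //; first exact: cont_diff_cst.
apply: cont_diff_mulmx => //; first exact: cont_diff_cst.
apply: (cont_diff_comp oI oD _ _ (cont_diff_jacobian oD (sD r.+1))).
  move=> x [z iz <-]; exists (z, 1%g) => //.
  by split=> //=; rewrite act1.
apply: cont_diff_row_mx => //; [exact: cont_diff_id|exact: cont_diff_cst].
Qed.

Lemma vertical_frame_change (i i' : idx AN) z : dom i z -> dom i' z ->
  vertical_frame i' (crd i' z) = vertical_frame i (crd i z) *m change i i' z.
Proof.
move=> iz iz'; rewrite !vertical_frameE// -mulmxA; congr (_ *m _).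
have iz1 : dom i (act lam z 1%g) by rewrite act1.
have iz1' : dom i' (act lam z 1%g) by rewrite act1.
by rewrite (jac_change_cod rO rN (smooth_orbit lam z) j1 iz1 iz1') act1.
Qed.

Lemma vertical_frame_proj (i : idx AN) (q : idx AM) z :
  dom i z -> dom q (Defs.proj lam z) ->
  vertical_frame i (crd i z) *m Jp i q z = 0.
Proof.
by move=> iz qz; rewrite vertical_frameE// -mulmxA jac_orbit_proj// mulmx0.
Qed.

(** A combination of the fundamental fields that vanishes at z is the fundamental
    field of a vector of V that is tangent to the stabilizer of z. *)
Lemma vertical_frame_free (i : idx AN) z (u : 'rV[R]_d) :
  V `&` stabilizer_tspace lam z = [set 0] -> dom i z ->
  u *m vertical_frame i (crd i z) = 0 -> u = 0.
Proof.
move=> Vcap iz; rewrite vertical_frameE// mulmxA mul_components.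
set v := \sum_l _ => v0.
have Vv : V v by apply: b_basis.1.
have : (V `&` stabilizer_tspace lam z) v.
  by split => //; apply/(stabilizer_tspaceP lam v j1 iz); split => //; exact: V_lie.
rewrite Vcap => vE; have := basis_mx j1 V_lie b_basis => -[fb _].
apply: (row_free_inj fb); rewrite mul0mx mul_components -/v.
by rewrite vE.
Qed.

End Vertical.

Section Horizontal.
Variable phi : N -> tvec AN -> tvec AN.
Hypothesis phi_conn : connection lam phi.
Variable Phi : idx AN -> 'rV[R]_(n + d) -> 'M[R]_(n + d).
Hypothesis Phi_smooth : forall i, smooth_on (crd i @` dom i) (Phi i).
Hypothesis PhiE : forall i z v, dom i z -> tspace AN z v ->
  phi z v i = v i *m Phi i (crd i z).

Lemma connection_idem (i : idx AN) z : dom i z ->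
  Phi i (crd i z) *m Phi i (crd i z) = Phi i (crd i z).
Proof.
case: phi_conn => -[phiT _] _ phi2 _ _ iz; apply/row_matrixP => l.
rewrite row_mul !rowE; set u := delta_mx _ _.
have tu := tangent_of_tspace rN u iz.
have := congr1 (fun v => v i) (phi2 z _ tu).
by rewrite !PhiE ?tangent_ofE//; exact: phiT.
Qed.

Lemma connection_proj (i : idx AN) (q : idx AM) z :
  dom i z -> dom q (Defs.proj lam z) -> Phi i (crd i z) *m Jp i q z = 0.
Proof.
case: phi_conn => _ phiV _ _ _ iz qz; apply/row_matrixP => l.
rewrite row_mul row0 rowE; set u := delta_mx _ _.
have tu := tangent_of_tspace rN u iz.
have [tphi /(tmap_eq0 rN rM sP tphi iz qz).2] := phiV z _ tu.
by rewrite PhiE// tangent_ofE.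
Qed.

Lemma connection_vertical (i : idx AN) (q : idx AM) z p (H : 'M[R]_(p, n + d)) :
  dom i z -> dom q (Defs.proj lam z) -> H *m Jp i q z = 0 ->
  H *m Phi i (crd i z) = H.
Proof.
case: phi_conn => _ _ _ phiid _ iz qz HJ; apply/row_matrixP => l.
rewrite row_mul; set u := row l H.
have tu := tangent_of_tspace rN u iz.
have uJ : u *m Jp i q z = 0 by rewrite -row_mul HJ row0.
have vu : vertical lam z (tangent_of i z u).
  by split=> //; apply/(tmap_eq0 rN rM sP tu iz qz); rewrite tangent_ofE.
have := congr1 (fun v => v i) (phiid z _ vu).
by rewrite PhiE// tangent_ofE.
Qed.

Lemma connection_change (i i' : idx AN) z : dom i z -> dom i' z ->
  change i i' z *m Phi i' (crd i' z) = Phi i (crd i z) *m change i i' z.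
Proof.
case: phi_conn => -[phiT _] _ _ _ _ iz iz'; apply/row_matrixP => l.
rewrite !row_mul ![row l _]rowE; set u := delta_mx _ _.
have tu := tangent_of_tspace rN u iz.
have := tspace_change (phiT z _ tu) iz iz'.
by rewrite !PhiE// (tspace_change tu iz iz') tangent_ofE.
Qed.

Definition base_frame (q : idx AM) z : 'M[R]_n :=
  components q (fun l => tb_vec (frame lam l z)).

(** The rows of H are the horizontal lifts at z of the base frame. *)
Definition horizontal (i : idx AN) z (H : 'M[R]_(n, n + d)) :=
  (forall q : idx AM, dom q (Defs.proj lam z) -> H *m Jp i q z = base_frame q z) /\
  H *m Phi i (crd i z) = 0.

Lemma frame_tspace l z : tspace AM (Defs.proj lam z) (tb_vec (frame lam l z)).
Proof. by rewrite -(frame_pt lam l z); exact: tb_tspace. Qed.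

Lemma base_frame_change (q q' : idx AM) z :
  dom q (Defs.proj lam z) -> dom q' (Defs.proj lam z) ->
  base_frame q' z = base_frame q z *m change q q' (Defs.proj lam z).
Proof.
move=> qz qz'; apply/row_matrixP => l; rewrite row_mul !rowK.
by rewrite (tspace_change (frame_tspace l z) qz qz').
Qed.

Lemma base_frame_unit (q : idx AM) z : dom q (Defs.proj lam z) ->
  base_frame q z \in unitmx.
Proof.
move=> qz; rewrite -row_free_unit.
by have [] := basis_mx qz (fun v tv => tv) (frame_basis lam z).
Qed.

Lemma horizontal_uniq (i : idx AN) z H H' :
  dom i z -> horizontal i z H -> horizontal i z H' -> H = H'.
Proof.
move=> iz [HJ HP] [HJ' HP']; have [q qz] := @chart_cover _ _ _ AM (Defs.proj lam z).
apply/subr0_eq; rewrite -(connection_vertical iz qz (H := H - H')).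
  by rewrite mulmxBl HP HP' subrr.
by rewrite mulmxBl HJ// HJ'// subrr.
Qed.

(** Lift the base frame arbitrarily, through a right inverse of the projection,
    and remove the vertical part. *)
Lemma horizontal_exists (i : idx AN) (q : idx AM) z (C : 'M[R]_(n, n + d)) :
  dom i z -> dom q (Defs.proj lam z) -> C *m Jp i q z \in unitmx ->
  horizontal i z (base_frame q z *m (invmx (C *m Jp i q z) *m C) *m
                  (1%:M - Phi i (crd i z))).
Proof.
move=> iz qz uC; split; last first.
  by rewrite -mulmxA mulmxBl mul1mx connection_idem// subrr mulmx0.
have E : base_frame q z *m (invmx (C *m Jp i q z) *m C) *m
    (1%:M - Phi i (crd i z)) *m Jp i q z = base_frame q z.
  rewrite -mulmxA mulmxBl mul1mx connection_proj// subr0.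
  by rewrite -!mulmxA mulVmx// mulmx1.
move=> q' qz'; rewrite (base_frame_change qz qz') -{2}E -[RHS]mulmxA.
congr (_ *m _).
exact: (jac_change_cod rN rM sP iz qz qz').
Qed.

Lemma horizontal_change (i i' : idx AN) z H : dom i z -> dom i' z ->
  horizontal i z H -> horizontal i' z (H *m change i i' z).
Proof.
move=> iz iz' [HJ HP]; split=> [q qz|]; rewrite -mulmxA.
  rewrite -HJ//; congr (_ *m _); symmetry.
  exact: (jac_change_dom rN sP iz iz' qz).
by rewrite connection_change// mulmxA HP mul0mx.
Qed.

(** Defined by its characterization, since the formula of [horizontal_exists]
    involves a chart of M and a matrix C that cannot be kept the same on the
    whole domain of the chart i. *)
Definition horizontal_frame (i : idx AN) (x : 'rV[R]_(n + d)) : 'M[R]_(n, n + d) :=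
  xget 0 [set H | exists z, [/\ dom i z, crd i z = x & horizontal i z H]].

Lemma jac_proj_section (i : idx AN) (q : idx AM) z :
  dom i z -> dom q (Defs.proj lam z) ->
  exists C : 'M[R]_(n, n + d), C *m Jp i q z \in unitmx.
Proof.
move=> iz qz; have : row_full (Jp i q z) by rewrite /row_full rank_jac_proj.
by move=> /row_fullP[C CJ]; exists C; rewrite CJ unitmx1.
Qed.

Lemma horizontal_frameP (i : idx AN) z : dom i z ->
  horizontal i z (horizontal_frame i (crd i z)).
Proof.
move=> iz; rewrite /horizontal_frame; set X := (X in xget 0 X).
have : X (xget 0 X).
  apply: xgetPex; have [q qz] := @chart_cover _ _ _ AM (Defs.proj lam z).
  have [C uC] := jac_proj_section iz qz.
  eexists; exists z; split => //; exact: horizontal_exists uC.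
by move=> [z' [iz' /(sN iz' iz) ->]].
Qed.

Lemma smooth_base_frame (i : idx AN) (q : idx AM) :
  exists W : 'rV[R]_(n + d) -> 'M[R]_n,
    smooth_on (local_dom (A := AN) (B := AM) (Defs.proj lam) i q) W /\
    forall z, dom i z -> dom q (Defs.proj lam z) -> W (crd i z) = base_frame q z.
Proof.
pose rep l := local_rep (A := AN) (B := tb_atlas AM) (frame lam l) i q.
exists (fun x => \matrix_l rsubmx (rep l x)); split.
  move=> r; have [oD _] := sP i q.
  apply/cont_diff_mx => // l c; under eq_fun do rewrite mxE.
  apply: (cont_diff_mx _ _ oD).1.
  have := frame_smooth lam l i q => -[oF sF].
  have -> : local_dom (A := AN) (B := AM) (Defs.proj lam) i q =
      local_dom (A := AN) (B := tb_atlas AM) (frame lam l) i q.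
    apply/seteqP; split=> x [z [iz qz] <-]; exists z => //; split => //;
      by rewrite /= ?frame_pt// in qz *.
  apply: (cont_diff_comp oF openT _ (sF r)) => //.
  by apply: cont_diff_rsubmx; exact: openT.
move=> z iz qz; apply/row_matrixP => l; rewrite !rowK.
have qf : @dom _ _ _ (tb_atlas AM) q (frame lam l z) by rewrite /= frame_pt.
rewrite /rep (@local_repE R _ _ _ _ AN (tb_atlas AM) sN (frame lam l) i q z iz qf).
by rewrite /= row_mxKr.
Qed.

(** Near a given point, one chart q of M and one matrix C will do, since
    invertibility is an open condition; by uniqueness the explicit lift built
    from them is the horizontal frame. *)
Lemma smooth_horizontal_frame (i : idx AN) :
  smooth_on (crd i @` dom i) (horizontal_frame i).
Proof.
move=> r; apply: cont_diff_local => x [z iz <-].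
have oI : open (crd i @` dom i) by exact: (open_chart_image idN).
have [q qz] := @chart_cover _ _ _ AM (Defs.proj lam z).
have [C uC] := jac_proj_section iz qz.
have [W [sW WE]] := smooth_base_frame i q.
have [oD sD] := sP i q.
set D := local_dom _ i q in oD sD sW.
pose CJ x := C *m 'J (local_rep (A := AN) (B := AM) (Defs.proj lam) i q) x.
have sCJ l : cont_diff l D CJ.
  apply: cont_diff_mulmx => //; first exact: cont_diff_cst.
  exact: cont_diff_jacobian.
pose U := D `&` [set x | CJ x \in unitmx].
have oU : open U by exact: open_unitmx.
have UD : U `<=` D by move=> y [].
have UI : U `<=` crd i @` dom i by move=> y [[z' [iz' _] <-] _]; exists z'.
exists U; first by split => //; exists z.
apply: (@cont_diff_ext _ _ _ _ _
  (fun x => W x *m (invmx (CJ x) *m C) *m (1%:M - Phi i x))) => //.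
  move=> y; rewrite inE => -[[z' [iz' qz'] <-] uz'].
  apply: (horizontal_uniq iz'); last exact: horizontal_frameP.
  by rewrite WE//; exact: horizontal_exists.
have cW : cont_diff r U W := cont_diff_sub UD (sW r).
have cCJ : cont_diff r U CJ := cont_diff_sub UD (sCJ r).
have cPhi : cont_diff r U (Phi i) := cont_diff_sub UI (Phi_smooth i r).
have cI : cont_diff r U (fun x => invmx (CJ x)).
  by apply: cont_diff_invmx cCJ; [exact: oU|move=> y []].
have cC : cont_diff r U (fun=> C) := cont_diff_cst _ _ C.
have cN : cont_diff r U (fun x => 1%:M - Phi i x).
  have -> : (fun x => 1%:M - Phi i x) = (fun x => 1%:M + Phi i x *m - 1%:M).
    by apply/funext => y; rewrite mulmxN mulmx1.
  exact: (cont_diff_add oU (cont_diff_cst _ _ _)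
    (cont_diff_mulmx oU cPhi (cont_diff_cst _ _ _))).
exact: (cont_diff_mulmx oU (cont_diff_mulmx oU cW (cont_diff_mulmx oU cI cC)) cN).
Qed.

End Horizontal.
End Frame.

(** * Triviality of the tangent bundle *)

(** The horizontal and vertical rows together are independent: the projection
    kills the vertical rows and maps the horizontal ones to a basis, so in a
    vanishing combination the horizontal coefficients are zero, and then the
    vertical ones are. *)
Lemma trivial_of_connection (R : realType) n d k (M N : topologicalType)
    (O : topologicalGroupCarrier) (AM : manifold R n M) (AN : manifold R (n + d) N)
    (AO : lie_group R k O) (lam : s_space AM AN AO) (V : set (tvec AO))
    (b : 'I_d -> tvec AO) :
  V `<=` lie_algebra AO -> is_basis b V ->
  (forall z : N, V `&` stabilizer_tspace lam z = [set 0]) ->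
  (exists phi, connection lam phi) -> trivial_tangent_bundle AN.
Proof.
move=> V_lie bV V_cap [phi phi_conn].
have [j j1] := @chart_cover _ _ _ AO 1%g.
have [[_ /choice[Phi PhiP]] _ _ _ _] := phi_conn.
have Phi_smooth i := (PhiP i).1.
have PhiE i z v : dom i z -> tspace AN z v -> phi z v i = v i *m Phi i (crd i z).
  exact: (PhiP i).2.
pose B i x := col_mx (horizontal_frame lam Phi i x) (vertical_frame lam j b i x).
have idN : smooth AN AN id by exact: smooth_id_mfd.
apply: (@trivial_of_frame _ _ _ _ B) => [i r|i z iz|i i' z iz iz'].
- have oI : open (crd i @` dom i) by exact: (open_chart_image idN).
  apply: (cont_diff_col_mx oI); last exact: smooth_vertical_frame.
  exact: (smooth_horizontal_frame phi_conn Phi_smooth PhiE).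
- rewrite -row_free_unit; apply: inj_row_free => u.
  rewrite /B -[u]hsubmxK mul_row_col => u0.
  have [q qz] := @chart_cover _ _ _ AM (Defs.proj lam z).
  have [HJ _] := horizontal_frameP phi_conn PhiE iz.
  have ul0 : lsubmx u = 0.
    have := congr1 (mulmx^~ (jac (A := AN) (B := AM) (Defs.proj lam) i q z)) u0.
    rewrite mul0mx mulmxDl -[lsubmx u *m _ *m _]mulmxA (HJ _ qz).
    rewrite -[rsubmx u *m _ *m _]mulmxA.
    rewrite (vertical_frame_proj j1 b iz qz) mulmx0 addr0.
    have fW : row_free (base_frame lam q z) by rewrite row_free_unit base_frame_unit.
    by move=> W0; apply: (row_free_inj fW); rewrite mul0mx.
  move: u0; rewrite ul0 mul0mx add0r.
  by move=> /(vertical_frame_free V_lie j1 bV (V_cap z) iz) ->; rewrite row_mx0.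
- rewrite /B mul_col_mx (vertical_frame_change lam j1 b iz iz'); congr col_mx.
  apply: (horizontal_uniq phi_conn PhiE iz').
    exact: (horizontal_frameP phi_conn PhiE iz').
  apply: (horizontal_change phi_conn PhiE iz iz').
  exact: (horizontal_frameP phi_conn PhiE iz).
Qed.

Lemma trivial_empty (R : realType) n (N : topologicalType) (AN : manifold R n N) :
  (N -> False) -> trivial_tangent_bundle AN.
Proof.
move=> N0; apply: (@trivial_of_frame _ _ _ _ (fun _ _ => 1%:M)).
- by move=> i r; exact: cont_diff_cst.
- by move=> i z; rewrite unitmx1.
- by move=> i i' z; have := N0 z.
Qed.

Theorem proposition30 (R : realType) (n m k : nat)
    (M N : topologicalType) (O : topologicalGroupCarrier)
    (AM : manifold R n M) (AN : manifold R m N) (AO : lie_group R k O)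
    (lam : s_space AM AN AO)
    (V : set (tvec AO))
    (V_subspace : linear_subspace V)
    (V_lie : V `<=` lie_algebra AO)
    (V_dim : vdim V = (k - stabilizer_dim lam)%N)
    (V_cap : forall z : N, V `&` stabilizer_tspace lam z = [set 0])
    (lam_connection : exists phi, connection lam phi) :
  trivial_tangent_bundle AN.
Proof.
have [[z _]|noN] := pselect (exists z : N, True); last first.
  by apply: trivial_empty => z; apply: noN; exists z.
have [j j1] := @chart_cover _ _ _ AO 1%g.
have [i iz] := @chart_cover _ _ _ AN z.
have [_ nm] := rank_orbit lam j1 iz.
have [d md] : exists d, m = (n + d)%N by exists (m - n)%N; rewrite subnKC.
subst m.
have := subspace_basis V_subspace V_lie j1.
rewrite V_dim (stabilizer_dimE lam z j1) => -[b bV].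
exact: trivial_of_connection V_lie bV V_cap lam_connection.
Qed.
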